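(* Let $\mu_1,\dots,\mu_d$ be Borel probability measures on $\mathbb{R}^d$ and assume there exist $p_1,\dots,p_d\in(1,+\infty)$ with $\sum_{i=1}^d\frac1{p_i}=1$ and $\sum_{i=1}^d\int_{\mathbb{R}^d}\frac{|x|^{p_i}}{p_i}\,d\mu_i(x)<+\infty$. Consider $$(\mathcal{MK})\quad\sup_{\gamma\in\Pi(\mu_1,\dots,\mu_d)}\int_{(\mathbb{R}^d)^d}\det(x_1,\dots,x_d)\,d\gamma(x_1,\dots,x_d)$$ and $$(\mathcal{D})\quad\inf_{(\phi_1,\dots,\phi_d)\in\mathcal{E}}\sum_{i=1}^d\int_{\mathbb{R}^d}\phi_i\,d\mu_i,$$ where $\mathcal{E}$ is the set of $d$-tuples of lower semicontinuous functions $\phi_i:\mathbb{R}^d\to\mathbb{R}\cup\{+\infty\}$ such that $\sum_{i=1}^d\phi_i(x_i)\ge\det(x_1,\dots,x_d)$ for all $(x_1,\dots,x_d)\in(\mathbb{R}^d)^d$. Then both $(\mathcal{MK})$ and $(\mathcal{D})$ admit solutions and $\max(\mathcal{MK})=\min(\mathcal{D})$. Moreover $(\mathcal{D})$ admits a solution $(\phi_1,\dots,\phi_d)$ such that for all $i=1,\dots,d$ and all $x_i\in\mathbb{R}^d$, $$\phi_i(x_i)=\sup_{(x_j)_{j\ne i}\in(\mathbb{R}^d)^{d-1}}\Bigl\{\det(x_1,\dots,x_d)-\sum_{j\ne i}\phi_j(x_j)\Bigr\}.$$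
   Context: $\det(x_1,\dots,x_d)$ is the determinant of the $d\times d$ matrix with columns $x_1,\dots,x_d\in\mathbb{R}^d$. $\Pi(\mu_1,\dots,\mu_d)$ denotes the set of Borel probability measures $\gamma$ on $(\mathbb{R}^d)^d$ whose $i$-th marginal (push-forward under the $i$-th canonical projection) equals $\mu_i$ for each $i$. *)

(* Defs.v *)
From HB Require Import structures.
From mathcomp Require Import all_boot all_order all_algebra.
From mathcomp Require Import all_classical all_reals all_analysis.
Set Implicit Arguments. Unset Strict Implicit. Unset Printing Implicit Defensive.
Import Order.TTheory GRing.Theory Num.Theory.
Import numFieldNormedType.Exports.
Local Open Scope classical_set_scope.
Local Open Scope ring_scope.

(* Points of R^d are column vectors 'cV[R]_d; a d-tuple (x_1,...,x_d) of
   points of R^d is the d x d matrix M whose j-th column is x_j, so that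
   det(x_1,...,x_d) = \det M and the j-th canonical projection is [col j]. *)

Definition BorelRd (R : realType) (d : nat) :=
  g_sigma_algebraType (@open 'cV[R]_d).

Definition BorelRdd (R : realType) (d : nat) :=
  g_sigma_algebraType (@open 'M[R]_d).

Definition enorm (R : realType) (d : nat) (x : 'cV[R]_d) : R :=
  Num.sqrt (\sum_(k < d) x k 0 ^+ 2).

Definition transport_plans (R : realType) (d : nat)
    (mu : 'I_d -> probability (BorelRd R d) R) :
    set (probability (BorelRdd R d) R) :=
  [set gam | forall (i : 'I_d) (A : set (BorelRd R d)), measurable A ->
      gam ((fun M : 'M[R]_d => col i M) @^-1` A) = mu i A].

Definition MK_cost (R : realType) (d : nat)
    (gam : probability (BorelRdd R d) R) : \bar R :=
  (\int[gam]_(M in setT) (\det (M : 'M[R]_d))%:E)%E.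

(* The set E of admissible d-tuples of lower semicontinuous functions
   R^d -> R U {+oo} with sum_i phi_i(x_i) >= det(x_1,...,x_d); we also
   require the negative parts to be integrable so that the dual functional
   sum_i int phi_i dmu_i is well defined in (-oo,+oo]. *)
Definition admissible (R : realType) (d : nat)
    (mu : 'I_d -> probability (BorelRd R d) R)
    (phi : 'I_d -> 'cV[R]_d -> \bar R) : Prop :=
  [/\ (forall i, lower_semicontinuous (phi i)),
      (forall i x, phi i x != -oo%E),
      (forall M : 'M[R]_d, ((\det M)%:E <= \sum_(i < d) phi i (col i M))%E) &
      (forall i, (\int[mu i]_(x in setT) ((phi i)^\- x)%E < +oo)%E)].

Definition dual_cost (R : realType) (d : nat)
    (mu : 'I_d -> probability (BorelRd R d) R)
    (phi : 'I_d -> 'cV[R]_d -> \bar R) : \bar R :=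
  (\sum_(i < d) \int[mu i]_(x in setT) phi i x)%E.

Definition conjugate_tuple (R : realType) (d : nat)
    (phi : 'I_d -> 'cV[R]_d -> \bar R) : Prop :=
  forall (i : 'I_d) (x : 'cV[R]_d),
    phi i x = ereal_sup [set ((\det M)%:E - \sum_(j < d | j != i) phi j (col j M))%E
                        | M in [set M : 'M[R]_d | col i M = x]].

(* Main.v *)
Require Import Defs.
From HB Require Import structures.
From mathcomp Require Import all_boot all_order all_algebra finmap.
From mathcomp Require Import all_classical all_reals all_analysis measurable_realfun.
From mathcomp Require Import perm lra.
Set Implicit Arguments. Unset Strict Implicit. Unset Printing Implicit Defensive.
Import Order.TTheory GRing.Theory Num.Theory.
Import numFieldNormedType.Exports.
Local Open Scope classical_set_scope.
Local Open Scope ring_scope.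

(** Both optimizers come from the functional sending f to the infimum of
    sum_i int phi_i dmu_i over integrable tuples with f <= sum_i phi_i(x_i).  It
    is sublinear, so by Hahn-Banach it dominates a linear L that agrees with it at
    the determinant.  On indicator functions L is a finitely additive content with
    marginals mu_i; as the mu_i are countably additive and tight, this content is
    regular on an algebra of sets that generates the Borel sets, hence extends to a
    plan gam, and L(det) <= int det dgam.

    A minimizing sequence phi^n of the dual problem has its excess
    sum_i phi_i^n(x_i) - det(x) tending to 0 on a set G of full gam-measure.  After
    normalizing at a point of G, an ultrafilter limit of phi^n is an admissible
    tuple with equality on G.  It need not be measurable, but conjugating its
    coordinates one after the other makes them suprema of continuous functions,
    hence lower semicontinuous, and preserves equality on G. *)

(** * Hahn-Banach theorem *)

(** The obstacle is a lack of compactness: the determinant is unbounded and changes sign, and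
    nothing bounds a minimizing sequence in advance. The estimate [|det M| <= osum h M], with [h_i]
    a multiple of [|x|^p_i], puts the determinant in the domain of the sublinear functional and lets
    its tails be cut off at small dual cost. That domain contains nonmeasurable functions, so the
    content is defined on every set of matrices. Content and plan may differ; what survives is that
    the plan gives closed sets at least as much mass, the right direction for the superlevel sets of
    a continuous cost. Potentials are determined only up to constants of sum zero, whence the
    normalization at a point. Integrability of the limit comes last: conjugation bounds each
    coordinate below by an integrable function, and equality on G turns the lower bounds of the
    others into an upper bound. *)

Section sublinear_functionals.
Variables (R : realType) (E : lmodType R) (S : set E).
Hypothesis SD : forall x y, S x -> S y -> S (x + y).
Hypothesis SZ : forall a x, S x -> S (a *: x).

(** [S] is a linear subspace given as a predicate; it will be the dominated functions inside the
    module of all functions. Homogeneity is asked as an inequality, since scaling back by the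
    inverse gives equality. *)
Definition sublinear (q : E -> R) :=
  (forall x y, S x -> S y -> q (x + y) <= q x + q y) /\
  (forall a x, 0 < a -> S x -> q (a *: x) <= a * q x).

Lemma sublinearZ q a x : sublinear q -> 0 < a -> S x -> q (a *: x) = a * q x.
Proof.
move=> [_ qZ] a0 Sx; apply/eqP; rewrite eq_le qZ//=.
have := qZ a^-1 (a *: x); rewrite invr_gt0 => /(_ a0 (SZ _ Sx)).
by rewrite scalerA mulVf ?gt_eqF// scale1r ler_pdivlMl.
Qed.

Lemma sublinear0 q x : sublinear q -> S x -> q 0 = 0.
Proof.
move=> sq Sx; have S0 : S 0 by rewrite -(scale0r x); exact: SZ.
have := sublinearZ sq (ltr0n _ 2) S0; rewrite scaler0; lra.
Qed.

Lemma sublinearN_ge q x : sublinear q -> S x -> - q (- x) <= q x.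
Proof.
move=> sq Sx; have SN : S (- x) by rewrite -scaleN1r; exact: SZ.
have := sq.1 _ _ Sx SN; rewrite subrr (sublinear0 sq Sx); lra.
Qed.

(** The largest sublinear functional below [q] with value at most [- q x0] at [- x0]: subadditivity
    along [x = (x + t *: x0) + t *: (- x0)] forces each of these bounds. *)
Definition tilt (q : E -> R) x0 x :=
  inf [set q (x + t *: x0) - t * q x0 | t in [set t | 0 <= t]].

Section tilt.
Variables (q : E -> R) (x0 : E).
Hypotheses (sq : sublinear q) (Sx0 : S x0).

Let SN x : S x -> S (- x).
Proof. by move=> Sx; rewrite -scaleN1r; exact: SZ. Qed.

(** A real [inf] is 0 on a set unbounded below; this bound makes [tilt] a genuine infimum. *)
Lemma tilt_lbound x : S x ->
  lbound [set q (x + t *: x0) - t * q x0 | t in [set t | 0 <= t]] (- q (- x)).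
Proof.
move=> Sx _ [t /= t0 <-].
have St : S (x + t *: x0) by apply: SD => //; exact: SZ.
have := sq.1 _ _ (SN Sx) St; rewrite addKr.
move: t0; rewrite [0 <= t]le_eqVlt => /orP[/eqP<-|t0].
  rewrite scale0r addr0 mul0r (sublinear0 sq Sx0) => h; lra.
rewrite (sublinearZ sq t0 Sx0) => h; lra.
Qed.

Lemma tilt_le x t : S x -> 0 <= t -> tilt q x0 x <= q (x + t *: x0) - t * q x0.
Proof.
move=> Sx t0; apply: ge_inf; last by exists t.
by exists (- q (- x)); exact: tilt_lbound.
Qed.

Lemma tilt_ge x y : S x ->
  (forall t, 0 <= t -> y <= q (x + t *: x0) - t * q x0) -> y <= tilt q x0 x.
Proof.
move=> Sx h; apply: lb_le_inf; last by move=> _ [t /= t0 <-]; exact: h.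
by exists (q (x + 0 *: x0) - 0 * q x0); exists 0 => /=.
Qed.

Lemma tilt_le_id x : S x -> tilt q x0 x <= q x.
Proof. by move=> Sx; have := tilt_le Sx (lexx 0); rewrite scale0r addr0 mul0r subr0. Qed.

Lemma tilt_opp : tilt q x0 (- x0) <= - q x0.
Proof.
have := tilt_le (SN Sx0) ler01; rewrite scale1r addNr mul1r.
by rewrite (sublinear0 sq Sx0) sub0r.
Qed.

Lemma sublinear_tilt : sublinear (tilt q x0).
Proof.
split=> [x y Sx Sy|a x a0 Sx].
- rewrite -lerBlDr; apply: tilt_ge => // t t0; rewrite lerBlDl -lerBlDr.
  apply: tilt_ge => // s s0; rewrite lerBlDl.
  have := tilt_le (SD Sx Sy) (addr_ge0 t0 s0).
  have := sq.1 (x + t *: x0) (y + s *: x0) (SD Sx (SZ _ Sx0)) (SD Sy (SZ _ Sx0)).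
  rewrite addrACA -scalerDl => h1 h2; lra.
- rewrite -ler_pdivrMl//; apply: tilt_ge => // t t0; rewrite ler_pdivrMl//.
  have := tilt_le (SZ a Sx) (mulr_ge0 (ltW a0) t0).
  rewrite -scalerA -scalerDr (sublinearZ sq a0); last exact: SD (SZ _ Sx0).
  by rewrite -mulrA -mulrBr.
Qed.

End tilt.

(* A pointwise minimal sublinear functional equals all its tilts, hence is odd,
   hence linear. *)
Lemma sublinear_minorant_linear (p : E -> R) : S !=set0 -> sublinear p ->
  exists q : E -> R, [/\ forall x, S x -> q x <= p x,
    forall x y, S x -> S y -> q (x + y) = q x + q y &
    forall a x, S x -> q (a *: x) = a * q x].
Proof.
move=> [s0 Ss0] sp.
have SN x : S x -> S (- x) by move=> Sx; rewrite -scaleN1r; exact: SZ.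
pose TT := {q : E -> R | sublinear q /\ forall x, S x -> q x <= p x}.
pose t0 : TT := exist _ p (conj sp (fun x _ => lexx (p x))).
(* The order is reversed, so a maximal element for Zorn's lemma is a minimal functional. *)
pose le (q1 q2 : TT) := `[< forall x, S x -> sval q2 x <= sval q1 x >].
have [] := @ZL_preorder TT t0 le.
- by move=> q; apply/asboolP.
- move=> q2 q1 q3 /asboolP h1 /asboolP h2; apply/asboolP => x Sx.
  exact: le_trans (h2 _ Sx) (h1 _ Sx).
- move=> A tA.
  have [->|/set0P[a Aa]] := eqVneq A set0; first by exists t0.
  pose B x := [set sval q x | q in A].
  have B0 x : B x !=set0 by exists (sval a x), a.
  have Bl x : S x -> has_lbound (B x).
    move=> Sx; exists (- p (- x)) => _ [[q [sq qp]] Aq <-] /=.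
    apply: le_trans (sublinearN_ge sq Sx); rewrite lerN2; exact/qp/SN.
  have leB x q : S x -> A q -> inf (B x) <= sval q x.
    by move=> Sx Aq; apply: ge_inf; [exact: Bl|exists q].
  have sB : sublinear (fun x => inf (B x)) /\
      forall x, S x -> inf (B x) <= p x.
    split; last first.
      by move=> x Sx; apply: le_trans (leB x a Sx Aa) _; case: (a) => q [? +] /=; exact.
    split=> [x y Sx Sy|b x b0 Sx].
    - rewrite -lerBlDr; apply: lb_le_inf => // _ [q1 Aq1 <-].
      rewrite lerBlDl -lerBlDr; apply: lb_le_inf => // _ [q2 Aq2 <-].
      rewrite lerBlDr.
      (* In a chain the smaller of the two functionals serves both points; this makes the pointwise
         infimum subadditive. *)
      have [q [Aq q1q q2q]] : exists q,
          [/\ A q, sval q x <= sval q1 x & sval q y <= sval q2 y].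
        by case: (tA _ _ Aq1 Aq2) => /asboolP h; [exists q2|exists q1];
           split=> //; exact: h.
      apply: le_trans (leB _ _ (SD Sx Sy) Aq) _.
      have := (proj2_sig q).1.1 _ _ Sx Sy => h.
      apply: le_trans h _; lra.
    - rewrite -ler_pdivrMl//; apply: lb_le_inf => // _ [q Aq <-].
      rewrite ler_pdivrMl//; apply: le_trans (leB _ _ (SZ _ Sx) Aq) _.
      exact: (proj2_sig q).1.2.
  exists (exist _ (fun x => inf (B x)) sB) => q Aq.
  by apply/asboolP => x Sx; exact: leB.
move=> [q [sq qp]] qmin; exists q.
have qN x : S x -> q (- x) = - q x.
  move=> Sx; apply/eqP; rewrite eq_le; apply/andP; split; last first.
    by rewrite lerNl; exact: sublinearN_ge.
  have tp : sublinear (tilt q x) /\ forall y, S y -> tilt q x y <= p y.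
    split; first exact: sublinear_tilt.
    by move=> y Sy; apply: le_trans (qp _ Sy); exact: tilt_le_id.
  (* The tilt lies below [q], so by minimality [q] lies below the tilt, whose value at [- x] is at
     most [- q x]. *)
  have /qmin : le (exist _ q (conj sq qp)) (exist _ (tilt q x) tp).
    by apply/asboolP => y Sy /=; exact: tilt_le_id.
  move=> /asboolP/(_ _ (SN _ Sx))/= h; apply: le_trans h _; exact: tilt_opp.
split => // [x y Sx Sy|a x Sx].
  apply/eqP; rewrite eq_le sq.1//=.
  have := sq.1 _ _ (SD Sx Sy) (SN _ Sy); rewrite addrK qN//; lra.
have [a0|a0|->] := ltgtP a 0.
- have a0' : 0 < - a by lra.
  by rewrite -[a *: x]opprK -scaleNr qN ?(sublinearZ sq)//; [lra|exact: SZ].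
- exact: sublinearZ.
- by rewrite scale0r mul0r (sublinear0 sq Sx).
Qed.

(** A linear minorant of [tilt p x0], rather than of [p], is at most [- p x0] at [- x0], which
    forces contact with [p] at [x0]. *)
Theorem hahn_banach_sublinear (p : E -> R) x0 : S x0 -> sublinear p ->
  exists q : E -> R, [/\ forall x, S x -> q x <= p x,
    forall x y, S x -> S y -> q (x + y) = q x + q y,
    forall a x, S x -> q (a *: x) = a * q x & q x0 = p x0].
Proof.
move=> Sx0 sp.
have [|q [qp qD qZ]] := sublinear_minorant_linear _ (sublinear_tilt sp Sx0).
  by exists x0.
have qp' x : S x -> q x <= p x.
  by move=> Sx; apply: le_trans (qp _ Sx) _; exact: tilt_le_id.
exists q; split => //; apply/eqP; rewrite eq_le qp'//=.
have := qp (- x0); rewrite -[in q _]scaleN1r qZ// => /(_ _).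
have := tilt_opp sp Sx0; rewrite -scaleN1r => h1 /(_ (SZ _ Sx0)) h2; lra.
Qed.

End sublinear_functionals.

(** * Extension of regular finitely additive contents *)

Section finitely_additive_content.
Context {R : realType} {T : Type} (nu : set T -> R).

Definition fin_additive :=
  (forall A, 0 <= nu A) /\
  (forall A B, A `&` B = set0 -> nu (A `|` B) = nu A + nu B).

Hypothesis nuP : fin_additive.

Lemma fin_additive0 : nu set0 = 0.
Proof. by have := nuP.2 set0 set0 (set0I _); rewrite setU0; lra. Qed.

Lemma fin_additiveD A B : A `<=` B -> nu B = nu A + nu (B `\` A).
Proof.
by move=> AB; rewrite -nuP.2 ?setDIK// setDUK.
Qed.

Lemma fin_additive_le A B : A `<=` B -> nu A <= nu B.
Proof. by move=> /fin_additiveD ->; rewrite lerDl nuP.1. Qed.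

Lemma fin_additiveU_le A B : nu (A `|` B) <= nu A + nu B.
Proof.
rewrite (@fin_additiveD A) ?lerD2l; last exact: subsetUl.
by apply: fin_additive_le => x [[]].
Qed.

Lemma fin_additive_bigcup_le (F : nat -> set T) n :
  nu (\big[setU/set0]_(i < n) F i) <= \sum_(i < n) nu (F i).
Proof.
elim: n => [|n ih]; first by rewrite !big_ord0 fin_additive0.
rewrite !big_ord_recr /=; apply: le_trans (fin_additiveU_le _ _) _; exact: lerD.
Qed.

Lemma fin_additive_bigcup (F : nat -> set T) n : trivIset setT F ->
  nu (\big[setU/set0]_(i < n) F i) = \sum_(i < n) nu (F i).
Proof.
move=> tF; elim: n => [|n ih]; first by rewrite !big_ord0 fin_additive0.
rewrite !big_ord_recr /= nuP.2 ?ih//; apply/seteqP; split => // x [].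
rewrite -bigcup_mkord => -[k /= kn Fk] Fn.
have kn' : k = n by apply: tF => //; exists x.
by rewrite kn' ltnn in kn.
Qed.

End finitely_additive_content.

Section regular_content.
Context (R : realType) (T : ptopologicalType) (nu : set T -> R).
Hypothesis nuP : fin_additive nu.
Hypothesis nuT : nu setT = 1.

(** These sets form an algebra, and tightness makes the content countably additive on it. *)
Definition nu_regular (A : set T) := forall e, 0 < e ->
  exists K U, [/\ closed K, open U, K `<=` A, A `<=` U & nu (U `\` K) <= e].

Lemma nu_regular0 : nu_regular set0.
Proof.
move=> e e0; exists set0, set0; split; [exact: closed0|exact: open0| | |] => //.
by rewrite setD0 (fin_additive0 nuP) ltW.
Qed.

Lemma nu_regularC : setC_closed nu_regular.
Proof.
move=> A rA e e0; have [K [U [cK oU KA AU ?]]] := rA e e0.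
exists (~` U), (~` K); split; [exact: open_closedC|exact: closed_openC|
  exact: subsetC|exact: subsetC|].
by rewrite setDE setCK setIC -setDE.
Qed.

Lemma nu_regularU : setU_closed nu_regular.
Proof.
move=> A B rA rB e e0; have e20 : 0 < e / 2 by lra.
have [K [U [cK oU KA AU hA]]] := rA _ e20.
have [L [V [cL oV LB BV hB]]] := rB _ e20.
exists (K `|` L), (U `|` V); split; [exact: closedU|exact: openU|
  exact: setUSS|exact: setUSS|].
apply: (@le_trans _ _ (nu ((U `\` K) `|` (V `\` L)))).
  apply: fin_additive_le => // x [[Ux|Vx] /not_orP[nK nL]]; by [left|right].
apply: le_trans (fin_additiveU_le nuP _ _) _; lra.
Qed.

Hypothesis nu_tight : forall e, 0 < e -> exists2 K, compact K & nu (~` K) <= e.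

Definition regT : Type := T.
HB.instance Definition _ := Pointed.on regT.
HB.instance Definition _ := @isAlgebraOfSets.Build default_measure_display regT
  nu_regular nu_regular0 nu_regularU nu_regularC.

Definition nuE (A : set regT) : \bar R := (nu A)%:E.

Let nuE_ge0 A : (0 <= nuE A)%E.
Proof. by rewrite lee_fin nuP.1. Qed.

Let nuE_semi_additive : measure_function.semi_additive nuE.
Proof.
by move=> F n _ tF _; rewrite /nuE (fin_additive_bigcup nuP)// sumEFin.
Qed.

HB.instance Definition _ := isContent.Build _ _ _ nuE nuE_ge0 nuE_semi_additive.

(** Alexandroff's argument: shrink [A] to a closed set, cut it by a compact set, enlarge each [F n]
    to an open set; a finite subcover reduces the claim to finite subadditivity. The three thirds of
    [e] pay for the shrinking, the part outside the compact set, and the enlargements. *)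
Let nuE_sigma_subadditive : measurable_subset_sigma_subadditive nuE.
Proof.
move=> A F mF mA AF; apply/lee_addgt0Pr => e e0.
have e30 : 0 < e / 3 by lra.
have [K0 [U0 [cK0 _ K0A AU h0]]] := mA _ e30.
have [C cC hC] := nu_tight e30.
have : forall n, exists U,
    [/\ open U, F n `<=` U & nu U <= nu (F n) + e / 3 / (2 ^ n.+1)%:R].
  move=> n; have en : 0 < e / 3 / (2 ^ n.+1)%:R by rewrite divr_gt0// ltr0n expn_gt0.
  have [K [U [cK oU KA FU h]]] := mF n _ en.
  exists U; split => //; rewrite (fin_additiveD nuP FU) lerD2l.
  by apply: le_trans h; apply: fin_additive_le => // x [Ux nF]; split => // /KA.
move=> /choice[U hU].
have cK : compact (C `&` K0) by exact: compact_closedI.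
rewrite compact_cover in cK.
have [|D _ KD] := cK _ setT U (fun i _ => let: And3 h _ _ := hU i in h).
  move=> x [_ /K0A/AF[n _ Fn]]; exists n => //; by have [_ FU _] := hU n; exact: FU.
have [N DN] : exists N, forall i, i \in D -> (i < N)%N.
  exists (\max_(i <- D) i).+1 => i iD; rewrite ltnS.
  exact: (@leq_bigmax_seq _ _ xpredT (fun i => i)).
have KU : C `&` K0 `<=` \big[setU/set0]_(i < N) U i.
  by move=> x /KD[i /= iD Ui]; rewrite -bigcup_mkord; exists i => //=; exact: DN.
have h1 : nu A <= e / 3 + (e / 3 + \sum_(i < N) nu (U i)).
  apply: (@le_trans _ _ (nu ((A `\` K0) `|` (~` C `|` (C `&` K0))))).
    apply: fin_additive_le => // x Ax.
    have [K0x|] := pselect (K0 x); last by left.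
    by have [Cx|] := pselect (C x); [right; right|right; left].
  apply: le_trans (fin_additiveU_le nuP _ _) _; apply: lerD.
    by apply: le_trans h0; apply: fin_additive_le => // x [Ax ?]; split=> //; exact: AU.
  apply: le_trans (fin_additiveU_le nuP _ _) _; apply: lerD => //.
  by apply: le_trans (fin_additive_bigcup_le nuP _ _); exact: fin_additive_le.
have h2 : (\sum_(i < N) (nu (U i))%:E <= \sum_(0 <= n <oo) nuE (F n) + (e / 3)%:E)%E.
  have := @epsilon_trick R (fun n => nuE (F n)) (e / 3) xpredT
    (fun n => nuE_ge0 (F n)) (ltW e30).
  apply: le_trans.
  apply: (@le_trans _ _ (\sum_(0 <= i < N) (nuE (F i) + (e / 3 / (2 ^ i.+1)%:R)%:E))%E).
    rewrite big_mkord; apply: lee_sum => i _; rewrite -EFinD lee_fin.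
    by have [_ _] := hU i.
  apply: nneseries_lim_ge => i _ _; rewrite adde_ge0// lee_fin divr_ge0//; lra.
apply: (@le_trans _ _ ((e/3)%:E + ((e / 3)%:E + \sum_(i < N) (nu (U i))%:E)))%E.
  by rewrite sumEFin -!EFinD lee_fin.
apply: (@le_trans _ _ ((e/3)%:E + ((e / 3)%:E + (\sum_(0 <= n <oo) nuE (F n) + (e / 3)%:E)))%E).
  by rewrite !leeD2l.
rewrite (addeC (\sum_(_ <= _ <oo) _))%E !addeA -!EFinD addeC.
by rewrite leeD2l// lee_fin; lra.
Qed.

HB.instance Definition _ :=
  Content_SigmaSubAdditive_isMeasure.Build _ _ _ nuE nuE_sigma_subadditive.

(** An open set itself can fail to be regular, because a finitely additive content may concentrate
    towards its boundary from inside. *)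
Hypothesis open_regular : forall U : set T, open U ->
  exists2 F : nat -> set T, (forall n, nu_regular (F n)) & U = \bigcup_n F n.

Definition borelT := g_sigma_algebraType (@open T).

Lemma borel_sub_regular (A : set T) :
  <<s @open T >> A -> <<s nu_regular >> A.
Proof.
apply: smallest_sub; first exact: smallest_sigma_algebra.
move=> U /open_regular[F rF ->].
apply: (@sigma_algebra_bigcup _ setT _ ) => n; exact: sub_sigma_algebra.
Qed.

Definition nu_ext (A : set borelT) : \bar R := measure_extension nuE A.

Let nu_ext0 : nu_ext set0 = 0%E.
Proof. exact: (@measure0 _ _ _ (measure_extension nuE)). Qed.

Let nu_ext_ge0 A : (0 <= nu_ext A)%E.
Proof. exact: (@measure_ge0 _ _ _ (measure_extension nuE)). Qed.

Let nu_ext_sigma_additive : semi_sigma_additive nu_ext.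
Proof.
move=> F mF tF mUF.
apply: (@measure_semi_sigma_additive _ _ _ (measure_extension nuE)) => //.
- by move=> i; exact: borel_sub_regular (mF i).
- exact: borel_sub_regular mUF.
Qed.

HB.instance Definition _ := isMeasure.Build _ _ _ nu_ext nu_ext0 nu_ext_ge0
  nu_ext_sigma_additive.

Lemma nu_extE A : nu_regular A -> nu_ext A = (nu A)%:E.
Proof.
by move=> rA; rewrite /nu_ext /measure_extension measurable_mu_extE.
Qed.

Let nu_extT : nu_ext setT = 1%E.
Proof.
rewrite nu_extE ?nuT//; rewrite -(setC0); exact: nu_regularC nu_regular0.
Qed.

HB.instance Definition _ := Measure_isProbability.Build _ _ _ nu_ext nu_extT.

(** Mass can only be lost on open sets: the extension is continuous along regular sets increasing to
    [U], whereas the content of [U] merely dominates theirs. By complementation, closed sets can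
    only gain. *)
Lemma nu_ext_open (U : set borelT) : open (U : set T) -> (nu_ext U <= (nu U)%:E)%E.
Proof.
move=> oU; have [F rF UF] := open_regular oU.
pose G n := \big[setU/set0]_(i < n) F i.
have rG n : nu_regular (G n).
  by apply: big_ind => //; [exact: nu_regular0|exact: nu_regularU].
have GU n : G n `<=` U.
  by rewrite UF /G -bigcup_mkord => x [i _ Fi]; exists i.
rewrite /nu_ext.
have cG : (measure_extension nuE \o G) @ \oo --> measure_extension nuE (\bigcup_n G n).
  apply: nondecreasing_cvg_mu.
  - by move=> n; apply: sub_sigma_algebra; exact: rG.
  - by apply: bigcup_measurable => n _; apply: sub_sigma_algebra; exact: rG.
  - apply/nondecreasing_seqP => n; apply/subsetPset => x.
    by rewrite /G big_ord_recr; left.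
have -> : U = \bigcup_n G n.
  rewrite UF; apply/seteqP; split => [x [n _ Fx]|x [n _]].
    by exists n.+1 => //; rewrite /G big_ord_recr; right.
  by rewrite /G -bigcup_mkord => -[i _ Fi]; exists i.
rewrite -(cvg_lim _ cG)//; apply: lime_le; first by apply/cvg_ex; eexists; exact: cG.
apply: nearW => n /=; rewrite -/(nu_ext (G n)) (nu_extE (rG n)) lee_fin.
by apply: fin_additive_le => // x Gx; exists n.
Qed.

Theorem regular_content_extension :
  exists gam : probability borelT R,
    (forall A, nu_regular A -> gam A = (nu A)%:E) /\
    (forall F, closed F -> ((nu F)%:E <= gam F)%E).
Proof.
exists nu_ext; split; first exact: nu_extE.
move=> F cF.
have oC : open (~` F) by exact: closed_openC.
have := nu_ext_open oC.
rewrite probability_setC; last first.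
  rewrite -[F]setCK; apply: measurableC; exact: sub_sigma_algebra.
have := fin_additiveD nuP (@subsetT _ F); rewrite nuT setTD => h.
have -> : nu (~` F) = 1 - nu F by lra.
have mF : measurable (F : set borelT).
  rewrite -[F]setCK; apply: measurableC; exact: sub_sigma_algebra.
have /fineK <- : (nu_ext : probability borelT R) F \is a fin_num.
  exact: fin_num_measure.
rewrite -EFinB !lee_fin; lra.
Qed.

End regular_content.

(** * Contents on matrices with prescribed marginals *)

Section borel_measurability.
Context (R : realType) (T : ptopologicalType).

Lemma borel_open (U : set T) : open U -> measurable (U : set (borelT T)).
Proof. by move=> oU; exact: sub_sigma_algebra. Qed.

Lemma borel_closed (F : set T) : closed F -> measurable (F : set (borelT T)).
Proof.
move=> cF; rewrite -[F]setCK; apply: measurableC; apply: borel_open.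
exact: closed_openC.
Qed.

Lemma borel_lsc_measurable (f : T -> \bar R) : lower_semicontinuous f ->
  measurable_fun setT (f : borelT T -> \bar R).
Proof.
move=> scif; apply: (measurability _ (ErealGenOInfty.measurableE R)).
move=> /= _ [_ [a ->]] <-; apply: measurableI => //; apply: borel_open.
by rewrite preimage_itvoy; move/lower_semicontinuousP : scif; exact.
Qed.

Lemma borel_continuous_measurable (f : T -> R) : continuous f ->
  measurable_fun setT (f : borelT T -> R).
Proof.
move=> /continuousP cf; apply: (measurability _ (RGenOpens.measurableE R)).
move=> _ [_ [a [b ->] <-]]; rewrite setTI; apply: borel_open.
exact/cf/interval_open.
Qed.

Lemma borel_continuous_measurable_borel (T2 : ptopologicalType) (f : T -> T2) :
  continuous f -> measurable_fun setT (f : borelT T -> borelT T2).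
Proof.
move=> /continuousP cf; apply: (@measurability _ _ _ (borelT T2) _ _ (@open T2)) => //.
by move=> _ [U oU <-]; rewrite setTI; apply: borel_open; exact: cf.
Qed.

End borel_measurability.

(** * Boxes and cubes in the space of matrices *)

Section matrix_boxes.
Context {R : realType} {m n : nat}.
Local Notation T := 'M[R]_(m, n).

Definition half_space (i : 'I_m) (j : 'I_n) (a : R) : set T :=
  [set M | M i j < a].

(** Half-open, so that a box is a finite intersection of open half-spaces and complements of open
    half-spaces; regularity is then checked on one kind of set. *)
Definition mx_box (q : T) (r : R) : set T :=
  [set M | forall i j, q i j - r <= M i j < q i j + r].

Definition mx_cube (N : nat) : set T := [set M | forall i j, `|M i j| <= N%:R].

Lemma closed_mx_cube N : closed (mx_cube N).
Proof.
have -> : mx_cube N = \bigcap_(ij in [set: 'I_m * 'I_n])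
    [set M : T | `|M ij.1 ij.2| <= N%:R].
  apply/seteqP; split => [M h [i j] _|M h i j]; first exact: h.
  exact: (h (i, j)).
apply: closed_bigI => -[i j] _ /=.
have c : continuous (fun M : T => `|M i j|).
  move=> M; apply: (@continuous_comp _ _ _ (fun M : T => M i j) (@Num.norm _ _)).
    exact: coord_continuous.
  exact: norm_continuous.
exact: (iffLR (continuous_closedP _) c _ (@closed_le R N%:R)).
Qed.

Lemma compact_mx_cube N : compact (mx_cube N).
Proof.
have c : compact [set v : 'rV[R]_(m * n) | forall i, v ord0 i \in `[- N%:R, N%:R]].
  have := @rV_compact _ (m * n) (fun=> `[- (N%:R : R), N%:R]%classic); apply => _.
  exact: segment_compact.
have -> : mx_cube N = vec_mx @` [set v : 'rV[R]_(m * n) |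
    forall i, v ord0 i \in `[- N%:R, N%:R]].
  apply/seteqP; split => [M h|_ [v h <-] i j].
    exists (mxvec M); last exact: mxvecK.
    move=> k; case/mxvec_indexP: k => i j; rewrite mxvecE /= in_itv /=.
    by rewrite -ler_norml.
  by rewrite mxE ler_norml; have := h (mxvec_index i j); rewrite /= in_itv.
apply: continuous_compact c; apply: continuous_subspaceT => v.
move=> A /nbhs_ballP[e e0 eA]; apply/nbhs_ballP; exists e => // w [_ vw].
apply: eA; split => // i j; rewrite !mxE; exact: vw.
Qed.

(** Boxes with rational centres and radii [1 / k.+1] are countably many; an index whose box does not
    fit in [U] contributes the empty set. *)
Lemma open_mx_boxes (U : set T) : open U -> exists2 F : nat -> set T,
  (forall k, F k = set0 \/ exists q r, F k = mx_box q r) & U = \bigcup_k F k.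
Proof.
move=> oU.
pose B (c : 'M[rat]_(m, n) * nat) := mx_box (map_mx ratr c.1) (c.2.+1%:R^-1).
pose F k := if (choice.unpickle k : option ('M[rat]_(m, n) * nat)%type) is Some c then
   (if `[< B c `<=` U >] then B c else set0) else set0.
exists F.
  move=> k; rewrite /F; case: choice.unpickle => [c|]; last by left.
  by case: ifPn => _; [right; exists (map_mx ratr c.1), (c.2.+1%:R^-1)|left].
apply/seteqP; split; last first.
  move=> M [k _]; rewrite /F; case: choice.unpickle => [c|//].
  by case: ifPn => // /asboolP BU /BU.
move=> M UM.
have : nbhs M U by exact: open_nbhs_nbhs.
move=> /nbhs_ballP[e /= e0 eU].
(* The factor 2: both [M] and any other point of the box are within [r] of the rational centre. *)
have [k ke] : exists k : nat, 2 * k.+1%:R^-1 < e.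
  have e20 : 0 < e / 2 by lra.
  have [k _ hk] := near_infty_natSinv_lt (PosNum e20).
  exists k; have /= h := hk k (leqnn k).
  move: h; set r := k.+1%:R^-1 => h; lra.
have k0 : 0 < k.+1%:R^-1 :> R by rewrite invr_gt0.
set r : R := k.+1%:R^-1 in k0 ke *.
have /choice[q hq] : forall ij : 'I_m * 'I_n, exists q : rat,
    (ratr q : R) \in `]M ij.1 ij.2 - r, M ij.1 ij.2 + r[.
  by move=> ij; apply: rat_in_itvoo; lra.
pose c : 'M[rat]_(m, n) * nat := (\matrix_(i, j) q (i, j), k).
have BM : B c M.
  by move=> i j; rewrite !mxE /= -/r; have := hq (i, j); rewrite in_itv /=; lra.
have BU : B c `<=` U.
  move=> N BN; apply: eU; split => // i j.
  have := BN i j; have := BM i j; rewrite !mxE /= -/r => h1 h2.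
  by rewrite /ball /= ltr_distlC; lra.
by exists (choice.pickle c) => //; rewrite /F choice.pickleK; case: ifPn => // /asboolP.
Qed.

End matrix_boxes.

(** Continuity from above. Through it the countable additivity of the marginals yields tightness and
    regularity for a content that is only finitely additive. *)
Lemma measure_small_tail d (T : measurableType d) (R : realType)
    (mu : probability T R) (F : nat -> set T) :
  (forall n, measurable (F n)) -> nonincreasing_seq F -> \bigcap_n F n = set0 ->
  forall e, 0 < e -> exists n, (mu (F n) <= e%:E)%E.
Proof.
move=> mF niF F0 e e0.
have := @nonincreasing_cvg_mu _ _ _ mu F.
rewrite F0 measure0 => /(_ _ mF measurable0 niF) h.
have {}h : mu \o F @ \oo --> 0%E.
  by apply: h; rewrite (le_lt_trans (probability_le1 _ _))// ltry.
have : \forall n \near \oo, (mu (F n) < e%:E)%E.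
  apply: (h [set y | (y < e%:E)%E]); apply: open_nbhs_nbhs; split.
    exact: open_ereal_lt_ereal.
  by rewrite /= lte_fin.
by case=> n _ hn; exists n; exact/ltW/hn/leqnn.
Qed.

Section plan_of_content.
Context (R : realType) (d : nat) (mu : 'I_d -> probability (BorelRd R d) R).
Variable nu : set 'M[R]_d -> R.
Hypotheses (nuP : fin_additive nu) (nuT : nu setT = 1).
Hypothesis nu_marginal : forall i (B : set (BorelRd R d)), measurable B ->
  (nu (col i @^-1` B))%:E = mu i B.

Lemma col_continuous (i : 'I_d) : continuous (fun M : 'M[R]_d => col i M).
Proof.
move=> M A /nbhs_ballP[e e0 eA]; apply/nbhs_ballP; exists e => // N [_ MN].
by apply: eA; split => // k j; rewrite !mxE; exact: MN.
Qed.

Lemma col_measurable (i : 'I_d) :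
  measurable_fun setT ((fun M : 'M[R]_d => col i M) : BorelRdd R d -> BorelRd R d).
Proof.
apply: (@borel_continuous_measurable_borel 'M[R]_d 'cV[R]_d (fun M => col i M)).
exact: col_continuous.
Qed.

(** A matrix outside the cube has a column outside it, so the complement is covered by [d] events on
    single columns, whose contents are marginal masses. *)
Lemma content_tight e : 0 < e -> exists2 K : set 'M[R]_d, compact K & nu (~` K) <= e.
Proof.
(* Dividing by [d.+1] avoids the case [d = 0]; the [d] terms still sum to at most [e]. *)
move=> e0; have e1 : 0 < e / d.+1%:R by rewrite divr_gt0.
pose F N : set (BorelRd R d) := ~` (mx_cube N : set 'cV[R]_d).
have : forall i, exists N, (mu i (F N) <= (e / d.+1%:R)%:E)%E.
  move=> i; apply: (@measure_small_tail _ _ _ (mu i) F) => //.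
  - by move=> N; apply: measurableC; apply: borel_closed; exact: closed_mx_cube.
  - apply/nonincreasing_seqP => N; apply/subsetPset; apply: subsetC => x h k j.
    by apply: le_trans (h k j) _; rewrite ler_nat.
  - apply/seteqP; split => // x h.
    have [N hN] : exists N : nat, forall k, `|x k 0| <= N%:R.
      exists (\max_k Num.truncn `|x k 0%R|%R).+1 => k.
      apply/ltW; apply: lt_le_trans (truncnS_gt _) _.
      by rewrite ler_nat ltnS; exact: (leq_bigmax k).
    by apply: (h N I) => k j; rewrite ord1.
move=> /choice[N hN]; pose N0 := \max_i N i.
exists (mx_cube N0); first exact: compact_mx_cube.
have sub : ~` mx_cube N0 `<=`
    \big[setU/set0]_(i < d) (col i @^-1` F (N i)).
  move=> M nM; apply: contrapT => h; apply: nM => k i.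
  apply: contrapT => hik; apply: h; rewrite -bigcup_seq; exists i.
    by rewrite /= mem_index_enum.
  move=> /= /(_ k 0); rewrite mxE => h'; apply: hik.
  by apply: le_trans h' _; rewrite ler_nat; exact: (leq_bigmax i).
apply: le_trans (fin_additive_le nuP sub) _.
have : nu (\big[setU/set0]_(i < d) (col i @^-1` F (N i))) <=
    \sum_(i < d) nu (col i @^-1` F (N i)).
  apply: (big_ind2 (fun A x => nu A <= x)) => //; first by rewrite (fin_additive0 nuP).
  by move=> A x B y hA hB; apply: le_trans (fin_additiveU_le nuP _ _) _; exact: lerD.
move=> /le_trans; apply.
apply: (@le_trans _ _ (\sum_(i < d) (e / d.+1%:R))).
  apply: ler_sum => i _; rewrite -lee_fin nu_marginal ?hN//.
  by apply: measurableC; apply: borel_closed; exact: closed_mx_cube.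
by rewrite sumr_const card_ord -[_ *+ d]mulr_natr mulrAC ler_pdivrMr// ler_pM2l// ler_nat.
Qed.

Lemma half_space_open i j a : open (half_space i j a : set 'M[R]_d).
Proof.
exact: (iffLR (continuousP _) (@coord_continuous R d d i j) _ (@open_lt R a)).
Qed.

(** The strip between the levels [a - n.+1^-1] and [a] is a condition on column [j] alone, so its
    content is a [mu j]-mass, and these strips decrease to the empty set. *)
Lemma half_space_regular i j a : nu_regular nu (half_space i j a).
Proof.
move=> e e0.
pose F n : set (BorelRd R d) := [set y : 'cV[R]_d | a - n.+1%:R^-1 < y i 0 < a].
have mF n : measurable (F n).
  apply: borel_open.
  have -> : F n = [set y : 'cV[R]_d | a - n.+1%:R^-1 < y i 0] `&` [set y : 'cV[R]_d | y i 0 < a].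
    by apply/seteqP; split => [y /andP[]|y [? ?]]; [|apply/andP].
  have c := @coord_continuous R d 1 i 0.
  apply: openI.
    exact: (iffLR (continuousP _) c _ (@open_gt R _)).
  exact: (iffLR (continuousP _) c _ (@open_lt R _)).
have [||n hn] := measure_small_tail (mu j) mF _ _ e0.
- apply/nonincreasing_seqP => n; apply/subsetPset => y /andP[h1 h2].
  apply/andP; split=> //; apply: le_lt_trans h1; rewrite lerD2l lerN2.
  by rewrite lef_pV2 ?posrE// ler_nat.
- apply/seteqP; split => // y h.
  have := h 0%N I => /andP[_ ya].
  have y0 : 0 < a - y i 0 by rewrite subr_gt0.
  have [k _ hk] := near_infty_natSinv_lt (PosNum y0).
  have /= := hk k (leqnn k) => h1; have /andP[h2 _] := h k I.
  by move: h1 h2; set r := k.+1%:R^-1 => h1 h2; lra.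
exists [set M : 'M[R]_d | M i j <= a - n.+1%:R^-1], (half_space i j a); split => //.
- exact: (iffLR (continuous_closedP _) (@coord_continuous R d d i j) _ (@closed_le R _)).
- exact: half_space_open.
- by move=> M /= h; apply: le_lt_trans h _; rewrite ltrBlDr ltrDl invr_gt0.
- rewrite -lee_fin; apply: le_trans hn; rewrite -nu_marginal// lee_fin.
  apply: fin_additive_le => // M [] /= h1 /negP; rewrite -ltNge => h2.
  by rewrite /preimage /F /= mxE h2 h1.
Qed.

Lemma setI_regular A B : nu_regular nu A -> nu_regular nu B -> nu_regular nu (A `&` B).
Proof.
move=> rA rB; rewrite -[A `&` B]setCK setCI.
by apply: nu_regularC; apply: nu_regularU => //; exact: nu_regularC.
Qed.

Lemma bigcap_regular (I : finType) (F : I -> set 'M[R]_d) :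
  (forall i, nu_regular nu (F i)) -> nu_regular nu [set M | forall i, F i M].
Proof.
move=> rF; have -> : [set M | forall i, F i M] = \big[setI/setT]_i F i.
  apply/seteqP; split => M; rewrite -bigcap_seq => h i; first by move=> _; exact: h.
  by apply: h; rewrite /= mem_index_enum.
apply: big_ind => //; last exact: setI_regular.
by rewrite -setC0; apply: nu_regularC; exact: nu_regular0.
Qed.

Lemma interval_regular i j a b : nu_regular nu [set M : 'M[R]_d | a <= M i j < b].
Proof.
have -> : [set M : 'M[R]_d | a <= M i j < b] = ~` half_space i j a `&` half_space i j b.
  apply/seteqP; split => M /=.
    by move=> /andP[h1 h2]; split => //; apply/negP; rewrite -leNgt.
  by move=> [/negP]; rewrite -leNgt => -> ->.
by apply: setI_regular; [apply: nu_regularC|]; exact: half_space_regular.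
Qed.

Lemma mx_box_regular q r : nu_regular nu (mx_box q r : set 'M[R]_d).
Proof.
have -> : mx_box q r = [set M : 'M[R]_d | forall ij : 'I_d * 'I_d,
    [set M : 'M[R]_d | q ij.1 ij.2 - r <= M ij.1 ij.2 < q ij.1 ij.2 + r] M].
  by apply/seteqP; split => M h; [move=> ij; exact: h|move=> i j; exact: (h (i, j))].
by apply: bigcap_regular => ij; exact: interval_regular.
Qed.

Lemma col_mx_box_regular i q r :
  nu_regular nu (col i @^-1` (mx_box q r : set 'cV[R]_d)).
Proof.
have -> : col i @^-1` (mx_box q r : set 'cV[R]_d) = [set M : 'M[R]_d | forall k,
    [set M : 'M[R]_d | q k 0 - r <= M k i < q k 0 + r] M].
  apply/seteqP; split => M h; first by move=> k; have := h k 0; rewrite mxE.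
  by move=> k j; rewrite mxE ord1; exact: h.
by apply: bigcap_regular => k; exact: interval_regular.
Qed.

Lemma cV_box_measurable q r : measurable (mx_box q r : set (BorelRd R d)).
Proof.
have -> : mx_box q r = \bigcap_(k in [set: 'I_d])
    ([set y : 'cV[R]_d | q k 0 - r <= y k 0] `&` [set y : 'cV[R]_d | y k 0 < q k 0 + r]).
  apply/seteqP; split => y h; first by move=> k _; have /andP[] := h k 0.
  by move=> k j; rewrite ord1; have [h1 h2] := h k I; apply/andP.
apply: fin_bigcap_measurable => // k _; have c := @coord_continuous R d 1 k 0.
apply: measurableI.
- apply: borel_closed.
  exact: (iffLR (continuous_closedP _) c _ (@closed_ge R _)).
- apply: borel_open; exact: (iffLR (continuousP _) c _ (@open_lt R _)).
Qed.

Theorem plan_of_content : exists gam : probability (BorelRdd R d) R,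
  transport_plans mu gam /\ (forall F, closed F -> ((nu F)%:E <= gam F)%E).
Proof.
have [|gam [gamE gamF]] := regular_content_extension nuP nuT content_tight.
  move=> U /open_mx_boxes[F hF ->]; exists F => // k.
  have [->|[q [r ->]]] := hF k; first exact: nu_regular0.
  exact: mx_box_regular.
exists gam; split => // i A mA.
(* On this pi-system [gam] agrees with the content, hence its marginal with [mu i]; it contains the
   boxes, so it generates the Borel sets. *)
pose G := [set A : set (BorelRd R d) | measurable A /\ nu_regular nu (col i @^-1` A)].
apply: esym; pose colB : BorelRdd R d -> BorelRd R d := fun M => col i M.
apply: (@measure_unique _ R (BorelRd R d) G (fun=> setT) _ _ _ _
  (mu i) (pushforward gam colB)) => //.
- apply/seteqP; split; last first.
    apply: smallest_sub; first exact: sigma_algebra_measurable.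
    by move=> ? [].
  apply: smallest_sub; first exact: smallest_sigma_algebra.
  move=> U /open_mx_boxes[F hF ->].
  apply: sigma_algebra_bigcup => k.
  have [->|[q [r ->]]] := hF k; first exact: sigma_algebra0.
  apply: sub_sigma_algebra; split; first exact: cV_box_measurable.
  exact: col_mx_box_regular.
- move=> B C [mB rB] [mC rC]; split; first exact: measurableI.
  exact: setI_regular.
- move=> _; split => //; rewrite preimage_setT -setC0.
  by apply: nu_regularC; exact: nu_regular0.
- by rewrite bigcup_const.
- exact: col_measurable.
- by move=> mcol B [mB rB]; rewrite /= /pushforward gamE// nu_marginal.
- by move=> _; rewrite (le_lt_trans (probability_le1 _ _))// ltry.
Qed.

End plan_of_content.

(** * The dual functional *)

Section real_integrable.
Context d (T : measurableType d) (R : realType) (P : probability T R).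

Definition rintegrable (f : T -> R) := P.-integrable setT (EFin \o f).

Lemma rintegrableD f g : rintegrable f -> rintegrable g ->
  rintegrable (fun x => f x + g x).
Proof. by move=> hf hg; exact: (integrableD measurableT hf hg). Qed.

Lemma rintegrableZ a f : rintegrable f -> rintegrable (fun x => a * f x).
Proof. by move=> hf; exact: (integrableZl measurableT a hf). Qed.

Lemma rintegrableB f g : rintegrable f -> rintegrable g ->
  rintegrable (fun x => f x - g x).
Proof. by move=> hf hg; exact: (integrableB measurableT hf hg). Qed.

Lemma rintegrable_cst a : rintegrable (fun=> a).
Proof. exact: finite_measure_integrable_cst. Qed.

Lemma rintegrable_measurable f : rintegrable f -> measurable_fun setT f.
Proof. by move=> /measurable_int/measurable_EFinP. Qed.

Lemma rintegrable_le (f g : T -> R) : measurable_fun setT f ->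
  (forall x, `|f x| <= g x) -> rintegrable g -> rintegrable f.
Proof.
move=> mf fg; apply: le_integrable => //; first exact/measurable_EFinP.
by move=> x _ /=; rewrite lee_fin; apply: le_trans (fg x) (ler_norm _).
Qed.

Lemma rintegrable_indic A : measurable A -> rintegrable (\1_A).
Proof.
move=> mA; apply: (@rintegrable_le _ (fun=> 1)); last exact: rintegrable_cst.
  exact: measurable_indic.
by move=> x; rewrite indicE; case: (x \in A); rewrite ?normr1 ?normr0.
Qed.

Lemma rintegrable_sum n (f : 'I_n -> T -> R) : (forall i, rintegrable (f i)) ->
  rintegrable (fun x => \sum_(i < n) f i x).
Proof.
elim: n f => [|n ih] f hf.
  by under eq_fun do rewrite big_ord0; exact: rintegrable_cst.
under eq_fun do rewrite big_ord_recr.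
by apply: rintegrableD => //; apply: ih.
Qed.

Lemma Rintegral_sum n (f : 'I_n -> T -> R) : (forall i, rintegrable (f i)) ->
  \int[P]_x (\sum_(i < n) f i x) = \sum_(i < n) \int[P]_x f i x.
Proof.
elim: n f => [|n ih] f hf.
  under eq_Rintegral do rewrite big_ord0.
  by rewrite Rintegral_cst// mul0r big_ord0.
under eq_Rintegral do rewrite big_ord_recr.
have h : rintegrable (fun x => \sum_(i < n) f (widen_ord (leqnSn n) i) x).
  by apply: rintegrable_sum.
by rewrite RintegralD ?ih ?big_ord_recr//; exact: hf.
Qed.

Lemma Rintegral_indic A : measurable A -> \int[P]_x (\1_A x) = fine (P A).
Proof. by move=> mA; rewrite /Rintegral integral_indic// setIT. Qed.

Lemma Rintegral_prob_cst a : \int[P]_x a = a.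
Proof. by rewrite Rintegral_cst// (_ : fine _ = 1) ?mulr1//= probability_setT. Qed.

Lemma rintegrable_point_le f e : rintegrable f -> 0 < e ->
  exists x, f x <= \int[P]_x f x + e.
Proof.
move=> hf e0; apply: contrapT => /forallNP h.
have : \int[P]_x (\int[P]_x f x + e) <= \int[P]_x f x.
  apply: le_Rintegral => //; first exact: rintegrable_cst.
  by move=> x _; apply/ltW; rewrite ltNge; apply/negP; exact: h.
by rewrite Rintegral_prob_cst; lra.
Qed.

End real_integrable.

(** * The dual value as a sublinear functional of the cost *)

Section kantorovich_functional.
Context (R : realType) (d : nat) (mu : 'I_d -> probability (BorelRd R d) R).
Local Notation T := 'M[R]_d.
Local Notation pot := ('I_d -> 'cV[R]_d -> R).

Definition rpot (phi : pot) := forall i, rintegrable (mu i) (phi i).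
Definition pot_cost (phi : pot) := \sum_(i < d) \int[mu i]_x phi i x.
Definition osum (phi : pot) (M : T) := \sum_(i < d) phi i (col i M).

Lemma rpotD phi psi : rpot phi -> rpot psi -> rpot (fun i x => phi i x + psi i x).
Proof. by move=> h1 h2 i; exact: rintegrableD. Qed.

Lemma rpotZ a phi : rpot phi -> rpot (fun i x => a * phi i x).
Proof. by move=> h i; exact: rintegrableZ. Qed.

Lemma pot_costD phi psi : rpot phi -> rpot psi ->
  pot_cost (fun i x => phi i x + psi i x) = pot_cost phi + pot_cost psi.
Proof.
move=> h1 h2; rewrite /pot_cost -big_split; apply: eq_bigr => i _.
by rewrite RintegralD//; [exact: h1|exact: h2].
Qed.

Lemma pot_costZ a phi : rpot phi ->
  pot_cost (fun i x => a * phi i x) = a * pot_cost phi.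
Proof.
move=> h; rewrite /pot_cost mulr_sumr; apply: eq_bigr => i _.
by rewrite RintegralZl//; exact: h.
Qed.

Lemma osumD phi psi M :
  osum (fun i x => phi i x + psi i x) M = osum phi M + osum psi M.
Proof. by rewrite /osum -big_split. Qed.

Lemma osumZ a phi M : osum (fun i x => a * phi i x) M = a * osum phi M.
Proof. by rewrite /osum mulr_sumr. Qed.

(** The hypothesis is tested at a matrix whose columns are points where each [phi i] is at most its
    mean plus a small error, so no joint measure is involved. This is what bounds dual values
    below. *)
Lemma pot_cost_ge0 phi : rpot phi -> (forall M, 0 <= osum phi M) ->
  0 <= pot_cost phi.
Proof.
move=> iphi h; apply/ler_addgt0Pr => e e0.
have e1 : 0 < e / d.+1%:R by rewrite divr_gt0.
have /choice[x hx] : forall i, exists x, phi i x <= \int[mu i]_x phi i x + e / d.+1%:R.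
  by move=> i; exact: (rintegrable_point_le (iphi i) e1).
have := h (\matrix_(k, i) x i k 0); rewrite /osum => /le_trans; apply.
apply: (@le_trans _ _ (\sum_(i < d) (\int[mu i]_x phi i x + e / d.+1%:R))).
  apply: ler_sum => i _; apply: le_trans (hx i).
  suff -> : col i (\matrix_(k, i) x i k 0) = x i by [].
  by apply/matrixP => k j; rewrite !mxE ord1.
rewrite big_split /= lerD2l sumr_const card_ord -[_ *+ d]mulr_natr mulrAC.
by rewrite ler_pdivrMr// ler_pM2l// ler_nat.
Qed.

(** No measurability is asked of [f], so that the indicator of every set of matrices is included. *)
Definition dominated (f : T -> R) :=
  exists2 g, rpot g & forall M, `|f M| <= osum g M.

Lemma dominatedD f g : dominated f -> dominated g -> dominated (f + g).
Proof.
move=> [a ia fa] [b ib gb]; exists (fun i x => a i x + b i x); first exact: rpotD.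
by move=> M; rewrite osumD; apply: le_trans (ler_normD _ _) _; exact: lerD.
Qed.

Lemma dominatedZ a f : dominated f -> dominated (a *: f).
Proof.
move=> [g ig fg]; exists (fun i x => `|a| * g i x); first exact: rpotZ.
by move=> M; rewrite osumZ /= /GRing.scale /= normrM ler_wpM2l.
Qed.

Lemma dominated_osum phi : rpot phi -> dominated (osum phi).
Proof.
move=> iphi; exists (fun i x => `|phi i x|); last by move=> M; exact: ler_norm_sum.
by move=> i; exact: integrable_abse (iphi i).
Qed.

Definition dual_values (f : T -> R) :=
  [set pot_cost phi | phi in [set phi | rpot phi /\ forall M, f M <= osum phi M]].

Definition dual_inf f := inf (dual_values f).

Lemma dual_values_nonempty f : dominated f -> dual_values f !=set0.
Proof.
move=> [g ig fg]; exists (pot_cost g), g => //; split => // M.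
by apply: le_trans (fg M); exact: ler_norm.
Qed.

Lemma dual_values_lbound f : dominated f -> has_lbound (dual_values f).
Proof.
move=> [g ig fg]; exists (- pot_cost g) => _ [phi [iphi fphi] <-].
rewrite -subr_ge0 opprK -pot_costD//; apply: pot_cost_ge0; first exact: rpotD.
move=> M; rewrite osumD; have := fphi M; have := fg M.
by rewrite ler_norml => /andP[]; lra.
Qed.

Lemma dual_inf_le f phi : dominated f -> rpot phi ->
  (forall M, f M <= osum phi M) -> dual_inf f <= pot_cost phi.
Proof.
by move=> df iphi h; apply: ge_inf; [exact: dual_values_lbound|exists phi].
Qed.

Lemma sublinear_dual_inf : sublinear dominated dual_inf.
Proof.
split => [f g df dg|a f a0 df].
- rewrite -lerBlDr; apply: lb_le_inf; first exact: dual_values_nonempty.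
  move=> _ [phi [iphi hphi] <-]; rewrite lerBlDr -lerBlDl.
  apply: lb_le_inf; first exact: dual_values_nonempty.
  move=> _ [psi [ipsi hpsi] <-]; rewrite lerBlDl -pot_costD//.
  apply: dual_inf_le; [exact: dominatedD|exact: rpotD|].
  by move=> M; rewrite osumD; exact: lerD.
- rewrite -ler_pdivrMl//; apply: lb_le_inf; first exact: dual_values_nonempty.
  move=> _ [phi [iphi hphi] <-]; rewrite ler_pdivrMl// -pot_costZ//.
  apply: dual_inf_le; [exact: dominatedZ|exact: rpotZ|].
  by move=> M; rewrite osumZ; apply: ler_wpM2l; [exact: ltW|exact: hphi].
Qed.

(** [L] stays below the dual value and meets it at [c]; the last clause expresses this contact
    through near-minimizers. *)
Theorem kantorovich_functional (c : T -> R) : dominated c ->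
  exists L : (T -> R) -> R,
  [/\ forall f g, dominated f -> dominated g -> L (f + g) = L f + L g,
      forall a f, dominated f -> L (a *: f) = a * L f,
      forall f phi, dominated f -> rpot phi -> (forall M, f M <= osum phi M) ->
        L f <= pot_cost phi &
      forall e, 0 < e -> exists phi, [/\ rpot phi,
        forall M, c M <= osum phi M & pot_cost phi < L c + e]].
Proof.
move=> dc.
have [L [Lp LD LZ Lc]] := hahn_banach_sublinear dominatedD dominatedZ dc sublinear_dual_inf.
exists L; split => // [f phi df iphi h|e e0].
  by apply: le_trans (Lp _ df) _; exact: dual_inf_le.
have := @inf_adherent _ (dual_values c) e e0
  (conj (dual_values_nonempty dc) (dual_values_lbound dc)).
by move=> [_ [phi [iphi h] <-]]; rewrite -/(dual_inf c) -Lc; exists phi.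
Qed.

End kantorovich_functional.

(** * The plan dominates the functional *)

Section plan_integrals.
Context (R : realType) (d : nat) (mu : 'I_d -> probability (BorelRd R d) R).
Variable gam : probability (BorelRdd R d) R.
Hypothesis gamP : transport_plans mu gam.

Lemma plan_integral_pushforward i (f : 'cV[R]_d -> \bar R) :
  (\int[pushforward gam (fun M : BorelRdd R d => col i M : BorelRd R d)]_x f x =
   \int[mu i]_x f x)%E.
Proof.
apply: eq_measure_integral => [|mcol A mA _]; first exact: col_measurable.
exact: (gamP i mA).
Qed.

Lemma plan_ge0_integral i (f : BorelRd R d -> \bar R) :
  measurable_fun setT f -> (forall x, 0 <= f x)%E ->
  (\int[gam]_M f (col i (M : 'M[R]_d)) = \int[mu i]_x f x)%E.
Proof.
move=> mf f0; rewrite -plan_integral_pushforward.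
rewrite (@ge0_integral_pushforward _ _ _ _ _ _ (col_measurable i) _ _ f)//.
Qed.

Lemma plan_integrable i (f : BorelRd R d -> \bar R) :
  (mu i).-integrable setT f ->
  gam.-integrable setT (fun M => f (col i (M : 'M[R]_d))).
Proof.
move=> /integrableP[mf foo]; apply/integrableP; split.
  exact: (measurableT_comp mf (col_measurable i)).
rewrite (@plan_ge0_integral i (fun x => `|f x|%E))//.
exact: measurableT_comp.
Qed.

(** For the optimal potentials, whose integrability is first obtained under the plan, where equality
    with the cost is available. *)
Lemma plan_integrable_inv i (f : BorelRd R d -> \bar R) :
  measurable_fun setT f -> gam.-integrable setT (fun M => f (col i (M : 'M[R]_d))) ->
  (mu i).-integrable setT f.
Proof.
move=> mf /integrableP[_ foo]; apply/integrableP; split => //.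
rewrite -(@plan_ge0_integral i (fun x => `|f x|%E))//.
exact: measurableT_comp.
Qed.

Lemma plan_integral i (f : BorelRd R d -> \bar R) : (mu i).-integrable setT f ->
  (\int[gam]_M f (col i (M : 'M[R]_d)) = \int[mu i]_x f x)%E.
Proof.
move=> fi; rewrite -plan_integral_pushforward.
rewrite (@integral_pushforward _ _ _ _ _ _ (col_measurable i))//.
- exact: measurable_int fi.
- exact: plan_integrable.
Qed.

Lemma plan_rintegrable_osum phi : rpot mu phi -> rintegrable gam (osum phi).
Proof.
move=> iphi; apply: (@rintegrable_sum _ _ _ gam d (fun i M => phi i (col i (M : 'M[R]_d)))).
by move=> i; exact: plan_integrable (iphi i).
Qed.

Lemma plan_Rintegral_osum phi : rpot mu phi ->
  \int[gam]_M osum phi M = pot_cost mu phi.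
Proof.
move=> iphi; rewrite /osum (@Rintegral_sum _ _ _ gam d (fun i M => phi i (col i (M : 'M[R]_d)))).
  by apply: eq_bigr => i _; congr fine; exact: (plan_integral (iphi i)).
by move=> i; exact: plan_integrable (iphi i).
Qed.

End plan_integrals.

Section layers.
Context {R : realType}.
Variables (r x : R).
Hypotheses (r0 : 0 < r) (x0 : 0 <= x).

(** For [0 <= x] this is [r * min K (floor (x / r))], written over superlevel conditions: a discrete
    layer-cake formula. *)
Definition layers K : R := \sum_(k < K) r * ((r * k.+1%:R <= x)%R : bool)%:R.

Lemma layersP K : (r * K%:R <= x -> layers K = r * K%:R) /\
  (x <= r * K%:R -> x - r <= layers K <= x).
Proof.
elim: K => [|K [ih1 ih2]].
  rewrite /layers big_ord0 mulr0; split => // x0'; apply/andP; split => //.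
  by rewrite subr_le0 (le_trans x0')// ltW.
rewrite /layers big_ord_recr /= -/(layers K).
have rK : r * K.+1%:R = r * K%:R + r by rewrite -natr1 mulrDr mulr1.
split => [h|h].
  by rewrite h mulr1 ih1 ?rK//; lra.
have [h'|h'] := leP (r * K.+1%:R) x.
  rewrite mulr1 ih1; last lra.
  by apply/andP; lra.
rewrite mulr0 addr0.
have [xK|xK] := leP x (r * K%:R); first exact: ih2.
by rewrite ih1; [apply/andP; lra|lra].
Qed.

End layers.

Lemma Rintegral_excess_cvg0 d (T : measurableType d) (R : realType)
    (P : probability T R) (h : T -> R) : rintegrable P h ->
  forall e, 0 < e -> exists n0 : nat, forall n : nat, (n0 <= n)%N ->
    rintegrable P (fun x => Num.max 0 (h x - n%:R)) /\
    \int[P]_x Num.max 0 (h x - n%:R) <= e.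
Proof.
move=> hi e e0.
have mh := rintegrable_measurable hi.
have mf n : measurable_fun setT (fun x => Num.max 0 (h x - n%:R)).
  by apply: measurable_maxr => //; apply: measurable_funB.
have fle n x : `|Num.max 0 (h x - n%:R)| <= `|h x|.
  rewrite ger0_norm ?le_max ?lexx// ge_max normr_ge0 /=.
  by apply: le_trans (ler_norm _); rewrite gerBl.
have hni : rintegrable P (fun x => `|h x|) by exact: integrable_abse hi.
have fi n : rintegrable P (fun x => Num.max 0 (h x - n%:R)).
  exact: rintegrable_le (mf n) (fle n) hni.
have [] := @dominated_convergence _ T R P setT measurableT
  (fun n x => (Num.max 0 (h x - n%:R))%:E) (fun=> 0%E) (fun x => `|h x|%:E).
- by move=> n; exact/measurable_EFinP.
- exact: measurable_cst.
- apply: aeW => x _.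
  apply: cvg_near_cst.
  exists (Num.truncn `|h x|).+1 => // n /= hn.
  congr EFin; apply/max_idPl; rewrite subr_le0.
  apply: le_trans (ler_norm _) _; apply/ltW; apply: lt_le_trans (truncnS_gt _) _.
  by rewrite ler_nat.
- exact: hni.
- by apply: aeW => x n _ /=; rewrite lee_fin.
move=> _ _; rewrite integral0 => h0.
have : \forall n \near \oo, (\int[P]_x (Num.max 0 (h x - n%:R))%:E < e%:E)%E.
  apply: (h0 [set y | (y < e%:E)%E]); apply: open_nbhs_nbhs; split.
    exact: open_ereal_lt_ereal.
  by rewrite /= lte_fin.
case=> n0 _ hn0; exists n0 => n hn; split => //.
have := hn0 n hn; rewrite /= -(fineK (integrable_fin_num measurableT (fi n))).
by rewrite lte_fin => /ltW.
Qed.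

(** * From the linear functional to a content, and comparison with the plan *)

Section plan_of_functional.
Context (R : realType) (d : nat) (mu : 'I_d -> probability (BorelRd R d) R).
Variable i0 : 'I_d.
Local Notation T := 'M[R]_d.
Local Notation dominated := (dominated mu).
Local Notation rpot := (rpot mu).
Local Notation pot_cost := (pot_cost mu).

(** Placed in one coordinate, a constant becomes a direct sum; hence the fixed index [i0]. *)
Definition single_pot (i : 'I_d) (f : 'cV[R]_d -> R) : 'I_d -> 'cV[R]_d -> R :=
  fun j x => if j == i then f x else 0.

Lemma rpot_single i f : rintegrable (mu i) f -> rpot (single_pot i f).
Proof.
move=> fi j; rewrite /single_pot; case: eqP => [->|_] //.
exact: rintegrable_cst.
Qed.

Lemma osum_single i f M : osum (single_pot i f) M = f (col i M).
Proof.
rewrite /osum (bigD1 i)//= /single_pot eqxx big1 ?addr0// => j /negbTE.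
by move=> ->.
Qed.

Lemma pot_cost_single i f : pot_cost (single_pot i f) = \int[mu i]_x f x.
Proof.
rewrite /pot_cost (bigD1 i)//= /single_pot eqxx big1 ?addr0// => j /negbTE ->.
exact: Rintegral_prob_cst.
Qed.

Lemma dominated_bounded f a : (forall M, `|f M| <= a) -> dominated f.
Proof.
move=> fa; exists (single_pot i0 (fun=> a)).
  by apply: rpot_single; exact: rintegrable_cst.
by move=> M; rewrite osum_single.
Qed.

Lemma dominated_indic A : dominated (\1_A).
Proof.
apply: (@dominated_bounded _ 1) => M; rewrite indicE.
by case: (M \in A); rewrite ?normr1 ?normr0.
Qed.

Variable L : (T -> R) -> R.
Hypothesis LD : forall f g, dominated f -> dominated g -> L (f + g) = L f + L g.
Hypothesis LZ : forall a f, dominated f -> L (a *: f) = a * L f.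
Hypothesis Lle : forall f phi, dominated f -> rpot phi ->
  (forall M, f M <= osum phi M) -> L f <= pot_cost phi.

Lemma functional_osum phi : rpot phi -> L (osum phi) = pot_cost phi.
Proof.
move=> iphi; have di := dominated_osum iphi.
apply/eqP; rewrite eq_le Lle//=.
have := @Lle ((-1) *: osum phi) (fun i x => (-1) * phi i x) (dominatedZ _ di) (rpotZ _ iphi).
rewrite LZ// pot_costZ// !mulN1r lerN2; apply => M.
by rewrite osumZ.
Qed.

Lemma functional_cst a : L (fun=> a) = a.
Proof.
have -> : (fun=> a) = osum (single_pot i0 (fun=> a)) by apply/funext => M; rewrite osum_single.
rewrite functional_osum; last by apply: rpot_single; exact: rintegrable_cst.
by rewrite pot_cost_single Rintegral_prob_cst.
Qed.

(** The difference lies below the zero direct sum, whose cost is 0. *)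
Lemma functional_le f g : dominated f -> dominated g ->
  (forall M, f M <= g M) -> L f <= L g.
Proof.
move=> df dg fg.
have dfg : dominated (f + (-1) *: g) by apply: dominatedD => //; exact: dominatedZ.
have i0' : rpot (single_pot i0 (fun=> 0)) by apply: rpot_single; exact: rintegrable_cst.
have := Lle dfg i0'; rewrite LD//; last exact: dominatedZ.
rewrite LZ// pot_cost_single Rintegral_prob_cst => h.
suff : L f + -1 * L g <= 0 by lra.
apply: h => M; rewrite osum_single.
by rewrite [leLHS](_ : _ = f M + -1 * g M)//; have := fg M; lra.
Qed.

Lemma functional_sum n (f : 'I_n -> T -> R) : (forall k, dominated (f k)) ->
  dominated (fun M => \sum_(k < n) f k M) /\
  L (fun M => \sum_(k < n) f k M) = \sum_(k < n) L (f k).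
Proof.
elim: n f => [|n ih] f df.
  under eq_fun do rewrite big_ord0.
  rewrite functional_cst big_ord0; split => //.
  by apply: (@dominated_bounded _ 0) => M; rewrite normr0.
have [d1 L1] := ih (fun k => f (widen_ord (leqnSn n) k)) (fun k => df _).
under eq_fun do rewrite big_ord_recr.
rewrite big_ord_recr /= -L1 -LD//; split => //.
exact: (dominatedD d1 (df ord_max)).
Qed.

Definition content_of (A : set T) : R := L (\1_A).

Lemma fin_additive_content_of : fin_additive content_of.
Proof.
split => [A|A B AB].
  rewrite -[leLHS](functional_cst 0); apply: functional_le.
  - by apply: (@dominated_bounded _ 0) => M; rewrite normr0.
  - exact: dominated_indic.
  - by move=> M; rewrite indicE.
rewrite /content_of -LD; [|exact: dominated_indic..].
congr L; apply/funext => M.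
rewrite [RHS](_ : _ = \1_A M + \1_B M)// !indicE.
have [/set_mem MA|/negP MA] := boolP (M \in A); have [/set_mem MB|/negP MB] := boolP (M \in B).
- by have : (A `&` B) M by []; rewrite AB.
- by rewrite addr0 mem_set//; left.
- by rewrite add0r mem_set//; right.
- by rewrite addr0 memNset// => -[/mem_set|/mem_set].
Qed.

Lemma content_ofT : content_of setT = 1.
Proof. by rewrite /content_of indicT functional_cst. Qed.

Lemma content_of_marginal i (B : set (BorelRd R d)) : measurable B ->
  (content_of (col i @^-1` B))%:E = mu i B.
Proof.
move=> mB; have iB := rintegrable_indic (mu i) mB.
have -> : content_of (col i @^-1` B) = L (osum (single_pot i (\1_B))).
  by congr L; apply/funext => M; rewrite osum_single !indicE.
rewrite functional_osum; last exact: rpot_single.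
by rewrite pot_cost_single (Rintegral_indic _ mB) fineK// fin_num_measure.
Qed.

Section bound.
Variable gam : probability (BorelRdd R d) R.
Hypothesis gamP : transport_plans mu gam.
Hypothesis gam_closed : forall F, closed F -> ((content_of F)%:E <= gam F)%E.

(** Up to [r], [f] is a positive combination of indicators of its closed superlevel sets, and on
    closed sets the content is at most the plan. *)
Lemma functional_le_Rintegral_ge0 (f : T -> R) a : continuous f ->
  (forall M, 0 <= f M <= a) -> L f <= \int[gam]_M f M.
Proof.
move=> cf fa; apply/ler_addgt0Pl => r r0.
have df : dominated f.
  by apply: (@dominated_bounded _ a) => M; have /andP[f0 ?] := fa M; rewrite ger0_norm.
pose K := (Num.truncn (`|a| / r)).+1.
have aK M : f M <= r * K%:R.
  have /andP[_ fMa] := fa M; apply: le_trans fMa _; apply: le_trans (ler_norm _) _.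
  by rewrite -ler_pdivrMl// mulrC; exact/ltW/truncnS_gt.
pose F (k : 'I_K) : set (BorelRdd R d) := [set M | r * k.+1%:R <= f M].
have cF k : closed (F k : set T).
  exact: (iffLR (continuous_closedP _) cf _ (@closed_ge R _)).
have mF k : measurable (F k) by exact: borel_closed (cF k).
pose s M := \sum_(k < K) (r *: (\1_(F k) : T -> R)) M.
have sE M : s M = layers r (f M) K.
  by apply: eq_bigr => k _; rewrite /GRing.scale /= indicE /F mem_setE.
have sP M : f M - r <= s M <= f M.
  have /andP[f0 _] := fa M.
  by rewrite sE; have [_] := layersP r0 f0 K; apply.
have dk k : dominated (r *: \1_(F k)) by apply: dominatedZ; exact: dominated_indic.
have [ds Ls] := functional_sum dk.
apply: (@le_trans _ _ (L ((fun=> r) + s))).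
  apply: functional_le => //.
    apply: dominatedD => //; apply: (@dominated_bounded _ r) => M.
    by rewrite gtr0_norm.
  by move=> M; rewrite [leRHS](_ : _ = r + s M)//; have /andP[] := sP M; lra.
rewrite LD//; last by apply: (@dominated_bounded _ r) => M; rewrite gtr0_norm.
rewrite functional_cst lerD2l Ls.
have ik k : rintegrable gam (r *: (\1_(F k) : BorelRdd R d -> R)).
  by apply: rintegrableZ; exact: rintegrable_indic.
apply: (@le_trans _ _ (\int[gam]_M s M)).
  rewrite (Rintegral_sum ik); apply: ler_sum => k _.
  rewrite LZ; last exact: dominated_indic.
  rewrite (RintegralZl r measurableT (rintegrable_indic gam (mF k))) (Rintegral_indic gam (mF k)).
  apply: ler_wpM2l; first exact: ltW.
  rewrite -lee_fin fineK ?fin_num_measure//; exact: gam_closed.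
apply: le_Rintegral => //.
- exact: (rintegrable_sum ik).
- apply: (@rintegrable_le _ _ _ gam f (fun=> a)); last exact: rintegrable_cst.
    exact: borel_continuous_measurable.
  by move=> M; have /andP[f0 ?] := fa M; rewrite ger0_norm.
- by move=> M _; have /andP[] := sP M.
Qed.

Variables (c : T -> R) (h : 'I_d -> 'cV[R]_d -> R).
Hypotheses (cc : continuous c) (ih : rpot h) (ch : forall M, `|c M| <= osum h M).

Lemma plan_rintegrable : rintegrable gam c.
Proof.
apply: (@rintegrable_le _ _ _ gam c (osum h)) => //.
  exact: borel_continuous_measurable.
exact: (plan_rintegrable_osum gamP ih).
Qed.

(** Truncating [c] to [[-B, B]] costs at most the direct sum of the excesses [max 0 (h_i - n)].
    Their total cost is at most [e / 2] and is paid twice, once under [L] and once under the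
    integral. *)
Lemma functional_le_Rintegral : L c <= \int[gam]_M c M.
Proof.
apply/ler_addgt0Pl => e e0; have e1 : 0 < e / 2 / d.+1%:R by rewrite !divr_gt0.
have /choice[n0 hn0] : forall i, exists n0 : nat, forall n : nat, (n0 <= n)%N ->
    rintegrable (mu i) (fun x => Num.max 0 (h i x - n%:R)) /\
    \int[mu i]_x Num.max 0 (h i x - n%:R) <= e / 2 / d.+1%:R.
  by move=> i; exact: Rintegral_excess_cvg0 (ih i) _ e1.
pose n := \max_i n0 i.
have hn i : (n0 i <= n)%N by exact: (leq_bigmax i).
pose u : 'I_d -> 'cV[R]_d -> R := fun i x => Num.max 0 (h i x - n%:R).
have iu : rpot u by move=> i; have [] := hn0 i n (hn i).
have cu : pot_cost u <= e / 2.
  apply: (@le_trans _ _ (\sum_(i < d) (e / 2 / d.+1%:R))).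
    by apply: ler_sum => i _; have [] := hn0 i n (hn i).
  rewrite sumr_const card_ord -[_ *+ d]mulr_natr mulrAC ler_pdivrMr//.
  by rewrite ler_wpM2l ?ler_nat//; lra.
(* Each [h i] exceeds [u i] by at most [n], so [osum h <= osum u + B] with [B = d * n]. *)
pose B : R := \sum_(i < d) n%:R.
have B0 : 0 <= B by apply: sumr_ge0.
have u0 M : 0 <= osum u M by apply: sumr_ge0 => i _; rewrite le_max lexx.
have uB M : osum h M - B <= osum u M.
  rewrite /osum -sumrB; apply: ler_sum => i _.
  by rewrite le_max lexx orbT.
clearbody B.
pose t M := Num.max (- B) (Num.min B (c M)).
have tB M : - B <= t M <= B.
  rewrite /t le_max lexx /= ge_max ge_min lexx /= andbT.
  by rewrite (le_trans _ B0)// oppr_le0.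
have ct M : c M <= t M + osum u M.
  have := u0 M; have := uB M; have := ch M; rewrite ler_norml => /andP[h1 h2] h3 h4.
  rewrite /t; case: (leP B (c M)) => h5.
    by case: (leP (- B) B) => h6; lra.
  by case: (leP (- B) (c M)) => h6; lra.
have tc M : t M <= c M + osum u M.
  have := u0 M; have := uB M; have := ch M; rewrite ler_norml => /andP[h1 h2] h3 h4.
  rewrite /t; case: (leP B (c M)) => h5.
    by case: (leP (- B) B) => h6; lra.
  by case: (leP (- B) (c M)) => h6; lra.
have ctt : continuous t.
  apply: (@max_fun_continuous _ T R (fun=> - B) (fun M => Num.min B (c M))).
    by move=> ?; exact: cst_continuous.
  apply: (@min_fun_continuous _ T R (fun=> B) c) => //.
  by move=> ?; exact: cst_continuous.
have dt : dominated t by apply: (@dominated_bounded _ B) => M; rewrite ler_norml.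
have dc : dominated c by exists h.
have dB : dominated (fun=> B).
  by apply: (@dominated_bounded _ B) => M; rewrite ger0_norm.
have Lt : L t <= \int[gam]_M t M.
  have it : rintegrable gam t.
    apply: (@rintegrable_le _ _ _ gam t (fun=> B)); last exact: rintegrable_cst.
      exact: borel_continuous_measurable.
    by move=> M; rewrite ler_norml.
  have := @functional_le_Rintegral_ge0 (t + (fun=> B)) (2 * B).
  rewrite LD// functional_cst (_ : \int[gam]_M _ = \int[gam]_M t M + B); last first.
    rewrite (RintegralD measurableT it (rintegrable_cst gam B)).
    by rewrite Rintegral_prob_cst.
  rewrite lerD2r; apply.
    by move=> M; apply: continuousD; [exact: ctt|exact: cst_continuous].
  by move=> M; rewrite [X in _ <= X <= _](_ : _ = t M + B)//; have := tB M; lra.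
have du := dominated_osum iu.
apply: (@le_trans _ _ (L (t + osum u))).
  by apply: functional_le => //; exact: dominatedD.
rewrite LD// functional_osum//.
have : \int[gam]_M t M <= \int[gam]_M (c M + osum u M).
  apply: le_Rintegral => //.
  - apply: (@rintegrable_le _ _ _ gam t (fun=> B)); last exact: rintegrable_cst.
      exact: borel_continuous_measurable.
    by move=> M; rewrite ler_norml.
  - exact: (rintegrableD plan_rintegrable (plan_rintegrable_osum gamP iu)).
rewrite (RintegralD measurableT plan_rintegrable (plan_rintegrable_osum gamP iu)).
rewrite (plan_Rintegral_osum gamP iu); lra.
Qed.

End bound.
End plan_of_functional.

(** * Conjugation and ultrafilter limits of potentials *)

Section set_col.
Context {R : realType} {d : nat}.

Definition set_col (i : 'I_d) (x : 'cV[R]_d) (M : 'M[R]_d) : 'M[R]_d :=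
  \matrix_(k, j) if j == i then x k 0 else M k j.

Lemma col_set_col i x M : col i (set_col i x M) = x.
Proof. by apply/matrixP => k j; rewrite !mxE eqxx ord1. Qed.

Lemma col_set_col_neq i j x M : j != i -> col j (set_col i x M) = col j M.
Proof. by move=> /negbTE ji; apply/matrixP => k l; rewrite !mxE ji. Qed.

Lemma set_col_id i M : set_col i (col i M) M = M.
Proof. by apply/matrixP => k j; rewrite !mxE; case: eqP => [->|]. Qed.

Lemma set_col_continuous i M : continuous (fun x => set_col i x M).
Proof.
move=> x A /nbhs_ballP[e e0 eA]; apply/nbhs_ballP; exists e => // y [_ xy].
apply: eA; split => // k j; rewrite !mxE; case: eqP => _; first exact: xy.
exact: ballxx.
Qed.

End set_col.

Section conjugation.
Context {R : realType} {d : nat} (c : 'M[R]_d -> R).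
Hypothesis cc : continuous c.
Local Notation epot := ('I_d -> 'cV[R]_d -> \bar R).
Local Open Scope ereal_scope.

Definition conj_pot (phi : epot) (i : 'I_d) (x : 'cV[R]_d) : \bar R :=
  ereal_sup [set (c M)%:E - \sum_(j < d | j != i) phi j (col j M)
            | M in [set M : 'M[R]_d | col i M = x]].

Lemma conj_potE phi psi i : (forall j, j != i -> phi j = psi j) ->
  conj_pot phi i = conj_pot psi i.
Proof.
move=> h; apply/funext => x; congr ereal_sup; apply/seteqP.
by split => _ [M Mx <-]; exists M => //; congr (_ - _); apply: eq_bigr => j ji; rewrite h.
Qed.

Lemma conj_pot_ge phi i x M :
  (c (set_col i x M))%:E - \sum_(j < d | j != i) phi j (col j M) <= conj_pot phi i x.
Proof.
apply: ereal_sup_ubound; exists (set_col i x M); first by rewrite /= col_set_col.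
by congr (_ - _); apply: eq_bigr => j ji; rewrite col_set_col_neq.
Qed.

(** Replacing only column [i] leaves the subtracted sum fixed, so each competitor is a continuous
    function of [x] minus an extended constant; an infinite constant makes it identically
    infinite. *)
Lemma conj_pot_lsc phi i : lower_semicontinuous (conj_pot phi i).
Proof.
move=> x a /ereal_sup_gt[_ [M Mx <-]] aM.
have [y hy] : exists s : \bar R, s = \sum_(j < d | j != i) phi j (col j M) by eexists.
rewrite -hy in aM.
suff [V Vx hV] : exists2 V, nbhs x V &
    forall z, V z -> a%:E < (c (set_col i z M))%:E - y.
  exists V => // z /hV/lt_le_trans; apply.
  by rewrite hy; exact: conj_pot_ge.
move: y aM {hy} => [y| |] aM.
- have cx : {for x, continuous (fun z => c (set_col i z M))}.
    apply: continuous_comp; [exact: set_col_continuous|exact: cc].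
  exists [set z | (a + y < c (set_col i z M))%R].
    apply: (cx [set r : R | (a + y < r)%R]); apply: open_nbhs_nbhs.
    split; first exact: open_gt.
    by rewrite /= -Mx set_col_id; move: aM; rewrite -EFinB lte_fin ltrBrDr.
  by move=> z /= h; rewrite -EFinB lte_fin ltrBrDr.
- by move: aM; rewrite addeNy.
- by exists setT => [|z _]; [exact: filterT|rewrite addey// ltry].
Qed.

(** Feasibility alone: the ultrafilter limit comes with neither semicontinuity nor integrability. *)
Definition super_pot (phi : epot) :=
  (forall i x, phi i x != -oo) /\
  (forall M, (c M)%:E <= \sum_(i < d) phi i (col i M)).

Lemma sum_neNy (phi : epot) (P : pred 'I_d) M : (forall i x, phi i x != -oo) ->
  \sum_(j < d | P j) phi j (col j M) != -oo.
Proof.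
move=> h; rewrite esum_eqNy; apply/negP => /existsP[i /andP[_ /eqP hi]].
by have := h i (col i M); rewrite hi.
Qed.

Lemma conj_pot_le phi i x : super_pot phi -> conj_pot phi i x <= phi i x.
Proof.
move=> [h1 h2]; apply: ge_ereal_sup => _ [M Mx <-].
have := h2 M; rewrite (bigD1 i)//= Mx.
have := @sum_neNy phi (fun j => j != i) M h1.
move: (\sum_(j < d | _) _) => [s _| _ _|//].
  by rewrite leeBlDr.
by rewrite addeNy leNye.
Qed.

Lemma conj_pot_neNy phi i x M0 : super_pot phi ->
  (forall i, phi i (col i M0) < +oo) -> conj_pot phi i x != -oo.
Proof.
move=> [h1 h2] h3; rewrite -ltNye; apply: lt_le_trans (conj_pot_ge _ _ _ M0).
have : \sum_(j < d | j != i) phi j (col j M0) < +oo by apply: lte_sum_pinfty.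
move: (\sum_(j < d | _) _) => [s _| //|_]; first by rewrite -EFinB ltNyr.
by rewrite addey.
Qed.

Lemma conj_pot_sum phi i M : (forall i x, phi i x != -oo) ->
  conj_pot phi i (col i M) != -oo ->
  (c M)%:E <= conj_pot phi i (col i M) + \sum_(j < d | j != i) phi j (col j M).
Proof.
move=> h1 h2; have := conj_pot_ge phi i (col i M) M; rewrite set_col_id.
have := @sum_neNy phi (fun j => j != i) M h1.
move: (\sum_(j < d | _) _) => [s _| _ _|//].
  by rewrite leeBlDr.
by rewrite addey// leey.
Qed.

Lemma conj_pot_anti phi psi i x : (forall i x, psi i x <= phi i x) ->
  conj_pot phi i x <= conj_pot psi i x.
Proof.
move=> h; apply: ge_ereal_sup => _ [M Mx <-].
apply: (@le_trans _ _ ((c M)%:E - \sum_(j < d | j != i) psi j (col j M))).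
  by apply: leeB => //; apply: lee_sum.
by apply: ereal_sup_ubound; exists M.
Qed.

(* Replacing the coordinates one after the other by their conjugates suffices:
   a coordinate that already is a conjugate stays one when the others decrease. *)
Theorem conjugate_pot_exists (phi : epot) M0 : super_pot phi ->
  (forall i, phi i (col i M0) < +oo) ->
  exists psi : epot, [/\ super_pot psi, forall i x, psi i x <= phi i x &
    forall i x, psi i x = conj_pot psi i x].
Proof.
move=> sphi phi0.
suff [psi [spsi psiphi psiC]] : exists psi : epot, [/\ super_pot psi,
    forall i x, psi i x <= phi i x &
    forall i, i \in enum 'I_d -> forall x, psi i x = conj_pot psi i x].
  by exists psi; split => // i x; apply: psiC; rewrite mem_enum.
elim: (enum 'I_d) => [|i s [psi [spsi psiphi psiC]]]; first by exists phi.
pose psi' : epot := fun j => if j == i then conj_pot psi i else psi j.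
have psi'N j : j != i -> psi' j = psi j by rewrite /psi' => /negbTE ->.
have psi0 j : psi j (col j M0) < +oo by apply: le_lt_trans (phi0 j).
have psi'psi j x : psi' j x <= psi j x.
  by rewrite /psi'; case: eqP => // ->; exact: conj_pot_le.
have ci : conj_pot psi' i = conj_pot psi i by apply: conj_potE.
have spsi' : super_pot psi'.
  split.
    move=> j x; rewrite /psi'; case: (j =P i) => [_|_]; last exact: spsi.1.
    exact: conj_pot_neNy spsi psi0.
  move=> M; rewrite (bigD1 i)//= [X in _ <= _ + X](eq_bigr (fun j => psi j (col j M))); last first.
    by move=> j ji; rewrite psi'N.
  rewrite [psi' i _](_ : _ = conj_pot psi i (col i M)); last by rewrite /psi' eqxx.
  by apply: conj_pot_sum; [exact: spsi.1|exact: conj_pot_neNy spsi psi0].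
exists psi'; split => // [j x|j].
  exact: le_trans (psi'psi _ _) _.
rewrite inE; have [-> _ x|ji /= js x] := eqVneq j i.
  by rewrite ci /psi' eqxx.
(* Lowering the other coordinates raises the conjugate at [j], and feasibility keeps that conjugate
   below coordinate [j], which was equal to the old one. *)
apply/eqP; rewrite eq_le conj_pot_le// andbT psi'N//.
by rewrite psiC//; exact: conj_pot_anti.
Qed.

End conjugation.

(** * Limits along an ultrafilter *)

Section ultralimit.
Context {R : realType} (U : set_system nat) {UU : UltraFilter U}.
Implicit Types v : nat -> R.

(** The limit along [U] in the extended reals, as the supremum of the lower bounds valid on a set of
    [U]; it is [-oo] when there are none. *)
Definition ulim v : \bar R := ereal_sup [set a%:E | a in [set a | U [set n | a <= v n]]].

Lemma ulim_ge v a : U [set n | a <= v n] -> (a%:E <= ulim v)%E.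
Proof. by move=> h; apply: ereal_sup_ubound; exists a. Qed.

Lemma ulim_le v b : U [set n | v n <= b] -> (ulim v <= b%:E)%E.
Proof.
move=> h; apply: ge_ereal_sup => _ [a /= ha <-]; rewrite lee_fin.
have /filter_ex[n [h1 h2]] : U ([set n | a <= v n] `&` [set n | v n <= b]).
  exact: filterI.
exact: le_trans h1 h2.
Qed.

Lemma ulim_fin v r e : ulim v = r%:E -> 0 < e -> U [set n | `|v n - r| <= e].
Proof.
move=> vr e0.
have h1 : U [set n | r - e <= v n].
  have : ((r - e)%:E < ulim v)%E by rewrite vr lte_fin ltrBlDr ltrDl.
  move=> /ereal_sup_gt[_ [a /= ha <-]]; rewrite lte_fin => ra.
  by apply: filterS ha => n /=; apply: le_trans; exact: ltW.
have h2 : U [set n | v n <= r + e].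
  (* Maximality of [U] enters here: either [r + e <= v n] on a set of [U], against the value of the
     limit, or the complement belongs to [U]. *)
  have [h|] := in_ultra_setVsetC [set n | r + e <= v n] UU.
    by have := ulim_ge h; rewrite vr lee_fin; lra.
  by apply: filterS => n /= /negP; rewrite -ltNge => /ltW.
by apply: filterS2 h1 h2 => n /= h1 h2; rewrite ler_distl h1 h2.
Qed.

Lemma ulim_sum d (v : 'I_d -> nat -> R) (r : 'I_d -> R) e :
  (forall i, ulim (v i) = (r i)%:E) -> 0 < e ->
  U [set n | `|\sum_(i < d) v i n - \sum_(i < d) r i| <= e].
Proof.
move=> vr e0; have e1 : 0 < e / d.+1%:R by rewrite divr_gt0.
have : U [set n | forall i, `|v i n - r i| <= e / d.+1%:R].
  by apply: filter_forall => i; exact: ulim_fin.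
apply: filterS => n /= h; rewrite -sumrB; apply: le_trans (ler_norm_sum _ _ _) _.
apply: (@le_trans _ _ (\sum_(i < d) (e / d.+1%:R))); first exact: ler_sum.
by rewrite sumr_const card_ord -[_ *+ d]mulr_natr mulrAC ler_pdivrMr// ler_pM2l// ler_nat.
Qed.

End ultralimit.

Section limit_potential.
Context {R : realType} {d : nat} (c : 'M[R]_d -> R) (i0 : 'I_d).
Variables (phi : nat -> 'I_d -> 'cV[R]_d -> R) (G : set 'M[R]_d) (M0 : 'M[R]_d).
Hypothesis phiP : forall n M, c M <= osum (phi n) M.
Hypothesis phiG : forall M, G M ->
  (fun n => osum (phi n) M - c M) @ \oo --> (0 : R).
Hypothesis GM0 : G M0.

(** The shift in [u] fixes every coordinate at the matching column of [M0], so the sequence cannot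
    drift along constants of sum zero; [k] makes the normalized sum at [M0] equal to [c M0]. *)
Let k : R := c M0 / d%:R.
Let u i x n := phi n i x - phi n i (col i M0) + k.

Let sum_k : \sum_(i < d) k = c M0.
Proof.
rewrite sumr_const card_ord -[_ *+ d]mulr_natr /k -mulrA mulVf ?mulr1//.
by rewrite pnatr_eq0; case: d i0 => // -[].
Qed.

Let sum_u M n : \sum_(i < d) u i (col i M) n = osum (phi n) M - osum (phi n) M0 + c M0.
Proof. by rewrite big_split sumrB sum_k. Qed.

Lemma limit_potential : exists psi : 'I_d -> 'cV[R]_d -> \bar R,
  super_pot c psi /\ forall M, G M ->
    (\sum_(i < d) psi i (col i M) = (c M)%:E)%E /\
    forall i, (psi i (col i M) < +oo)%E.
Proof.
have [U [UU Uoo]] := @ultraFilterLemma nat (\oo) _.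
have Ue M e : G M -> 0 < e -> U [set n | osum (phi n) M - c M <= e].
  move=> GM e0; apply: Uoo.
  have /cvgrPdist_le/(_ _ e0) := phiG GM.
  by apply: filterS => n /=; rewrite sub0r normrN; apply: le_trans; exact: ler_norm.
(* With column [i] of [M0] changed to [x], the other normalized coordinates equal [k], so the
   constraint there bounds coordinate [i] below; the 1 is the excess allowed at [M0]. *)
have Ulb i x : exists b, U [set n | b <= u i x n].
  exists (c (set_col i x M0) - 1 - \sum_(j < d | j != i) k).
  apply: filterS (Ue M0 1 GM0 ltr01) => n /= h.
  have := sum_u (set_col i x M0) n; rewrite (bigD1 i)//= col_set_col.
  rewrite (eq_bigr (fun=> k)); last first.
    by move=> j ji; rewrite /u col_set_col_neq// subrr add0r.
  have := phiP n (set_col i x M0); lra.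
(* On [G] the normalized sum is at most [c M + 1]; the lower bounds of the other coordinates then
   bound this one above. *)
have Uub i M : G M -> exists b, U [set n | u i (col i M) n <= b].
  move=> GM; have /choice[b hb] := fun j => Ulb j (col j M).
  exists (c M + 1 - \sum_(j < d | j != i) b j).
  have hb' : U [set n | forall j, b j <= u j (col j M) n] by exact: filter_forall.
  apply: filterS2 (Ue M 1 GM ltr01) hb' => n /= h1 h2.
  have := sum_u M n; rewrite (bigD1 i)//= => h3.
  have h4 : \sum_(j < d | j != i) b j <= \sum_(j < d | j != i) u j (col j M) n.
    exact: ler_sum.
  have := phiP n M0; lra.
pose psi i x := ulim U (u i x).
have psiN i x : psi i x != -oo%E.
  have [b hb] := Ulb i x; rewrite -ltNye; apply: lt_le_trans (ulim_ge hb).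
  exact: ltNyr.
have psi_lt i M : G M -> (psi i (col i M) < +oo)%E.
  move=> GM; have [b hb] := Uub i M GM.
  by apply: le_lt_trans (ulim_le hb) _; exact: ltry.
have psi_sum M : (forall i, psi i (col i M) < +oo)%E -> exists2 r,
    (\sum_(i < d) psi i (col i M) = r%:E)%E &
    forall e, 0 < e -> U [set n | `|osum (phi n) M - osum (phi n) M0 + c M0 - r| <= e].
  move=> h; have hr i : psi i (col i M) = (fine (psi i (col i M)))%:E.
    by rewrite fineK// fin_numE psiN -ltey h.
  exists (\sum_(i < d) fine (psi i (col i M))).
    by rewrite -sumEFin; apply: eq_bigr.
  move=> e e0.
  apply: filterS (@ulim_sum _ U _ d (fun i => u i (col i M)) _ e hr e0) => n /=.
  by rewrite sum_u.
exists psi; split; last first.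
  move=> M GM; have lt i := psi_lt i M GM; split => //.
  have [r -> hr] := psi_sum M lt; congr EFin.
  apply/eqP; rewrite -subr_eq0 -normr_le0; apply/ler_addgt0Pl => e e0; rewrite addr0.
  have e20 : 0 < e / 2 by lra.
  have /filter_ex[n [/= [h1 h2] h3]] : U ([set n | osum (phi n) M - c M <= e / 2] `&`
      [set n | osum (phi n) M0 - c M0 <= e / 2] `&`
      [set n | `|osum (phi n) M - osum (phi n) M0 + c M0 - r| <= e / 2]).
    by apply: filterI; [apply: filterI; exact: Ue|exact: hr].
  have := phiP n M; have := phiP n M0; move: h3; rewrite !ler_norml.
  move=> /andP[h3 h4] h5 h6; apply/andP; split; lra.
split => // M.
have [lt|] := pselect (forall i, psi i (col i M) < +oo)%E; last first.
  move=> /existsNP[i /negP]; rewrite -leNgt leye_eq => /eqP hi.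
  rewrite (bigD1 i)//= hi addye ?leey//; exact: sum_neNy.
have [r -> hr] := psi_sum M lt; rewrite lee_fin.
apply/ler_addgt0Pl => e e0; have e20 : 0 < e / 2 by lra.
have /filter_ex[n [/= h2 h3]] : U ([set n | osum (phi n) M0 - c M0 <= e / 2] `&`
    [set n | `|osum (phi n) M - osum (phi n) M0 + c M0 - r| <= e / 2]).
  by apply: filterI; [exact: Ue|exact: hr].
have := phiP n M; move: h3; rewrite ler_norml => /andP[_]; lra.
Qed.

End limit_potential.

(** The integrals sum to at most 1, so the series of the [e n] is finite almost everywhere and its
    terms tend to 0. *)
Lemma ae_cvg0_summable_integral d (T : measurableType d) (R : realType)
    (P : probability T R) (e : nat -> T -> R) :
  (forall n, rintegrable P (e n)) -> (forall n x, 0 <= e n x) ->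
  (forall n, \int[P]_x e n x <= (2 ^ n.+1)%:R^-1) ->
  {ae P, forall x, (e n x @[n --> \oo] --> (0 : R))}.
Proof.
move=> ie e0 he.
pose E x := (\sum_(0 <= n <oo) (e n x)%:E)%E.
have me n : measurable_fun setT (EFin \o e n) by exact: measurable_int (ie n).
have iE : (\int[P]_x E x <= 1)%E.
  rewrite integral_nneseries//; last by move=> n x _; rewrite lee_fin.
  have /(_ xpredT) := @epsilon_trick0 R 1 _ ler01; apply: le_trans.
  apply: lee_nneseries => [n _ _|n _].
    by apply: integral_ge0 => x _; rewrite lee_fin.
  rewrite -(fineK (integrable_fin_num measurableT (ie n))) lee_fin div1r.
  exact: he.
have E0 x : (0 <= E x)%E by apply: nneseries_ge0 => n _ _; rewrite lee_fin.
have mE : measurable_fun setT E.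
  apply: ge0_emeasurable_sum => [n x _ _|n _]; first by rewrite lee_fin.
  exact: me.
have : P.-integrable setT E.
  apply/integrableP; split => //.
  under eq_integral do rewrite gee0_abs//.
  by apply: le_lt_trans iE _; exact: ltry.
move=> /(integrable_ae measurableT); apply: filterS => x /(_ I) Ex.
apply: cvg_series_cvg_0; apply: nondecreasing_is_cvgn.
  apply/nondecreasing_seqP => n; rewrite /series /= big_nat_recr//=.
  by rewrite lerDl.
exists (fine (E x)) => _ [n _ <-]; rewrite -lee_fin fineK//.
rewrite /series /= -sumEFin; apply: nneseries_lim_ge => k _ _.
by rewrite lee_fin.
Qed.

(** * Duality for continuous costs *)

Lemma sube_neNy (R : realType) (x y : \bar R) :
  (0 <= x)%E -> y \is a fin_num -> (x - y != -oo)%E.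
Proof. by case: x y => [x| |] [y| |]. Qed.

Lemma sube_ltyl (R : realType) (x y : \bar R) :
  y \is a fin_num -> (x - y < +oo)%E -> (x < +oo)%E.
Proof. by case: x y => [x| |] [y| |] //= _; rewrite ?ltry. Qed.

Section duality.
Context (R : realType) (d : nat) (mu : 'I_d -> probability (BorelRd R d) R).
Variables (i0 : 'I_d) (c : 'M[R]_d -> R) (h : 'I_d -> 'cV[R]_d -> R).
Hypotheses (cc : continuous c) (ih : rpot mu h).
Hypothesis ch : forall M, `|c M| <= osum h M.
Local Notation epot := ('I_d -> 'cV[R]_d -> \bar R).

(** As [L c] is at most the integral of [c], near-minimizers for [L c] are close to that integral
    too. The errors are summable, so that the excesses vanish almost everywhere without extracting a
    subsequence. *)
Lemma plan_and_minimizing_potentials : exists2 gam : probability (BorelRdd R d) R,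
  transport_plans mu gam & exists phi : nat -> 'I_d -> 'cV[R]_d -> R,
  forall n, [/\ rpot mu (phi n), forall M, c M <= osum (phi n) M &
    pot_cost mu (phi n) <= \int[gam]_M c M + (2 ^ n.+1)%:R^-1].
Proof.
have dc : dominated mu c by exists h.
have [L [LD LZ Lle Lc]] := kantorovich_functional dc.
have nuP := fin_additive_content_of i0 LD LZ Lle.
have nuT := content_ofT i0 LZ Lle.
have [gam [gamP gamF]] := plan_of_content nuP nuT (content_of_marginal LZ Lle).
exists gam => //.
have Lgam := functional_le_Rintegral i0 LD LZ Lle gamP gamF cc ih ch.
have : forall n : nat, exists phi, [/\ rpot mu phi, forall M, c M <= osum phi M &
    pot_cost mu phi <= \int[gam]_M c M + (2 ^ n.+1)%:R^-1].
  move=> n; have e0 : 0 < (2 ^ n.+1)%:R^-1 :> R by rewrite invr_gt0 ltr0n expn_gt0.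
  have [phi [iphi cphi lphi]] := Lc _ e0; exists phi; split => //.
  by apply: le_trans (ltW lphi) _; rewrite lerD2r.
by move=> /choice[phi hphi]; exists phi.
Qed.

Section integrable_potential.
Variable gam : probability (BorelRdd R d) R.
Hypothesis gamP : transport_plans mu gam.

Let gam_c : rintegrable gam c := plan_rintegrable gamP cc ih ch.

(** Use [M0] with column [i] replaced by [x] as a competitor and bound [c] below by [- osum h]: only
    the term [h i x] varies with [x]. *)
Lemma conjugate_pot_lower_bound (psi : epot) M0 : super_pot c psi ->
  (forall i x, psi i x = conj_pot c psi i x) ->
  (forall i, psi i (col i M0) < +oo)%E ->
  exists g, [/\ rpot mu g, forall i x, 0 <= g i x &
    forall i x, (- (g i x)%:E <= psi i x)%E].
Proof.
move=> spsi psiC psi0.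
pose s i : R := \sum_(j < d | j != i) fine (psi j (col j M0)).
pose t i : R := \sum_(j < d | j != i) h j (col j M0).
exists (fun i x => `|h i x| + `|s i + t i|); split.
- move=> i; apply: rintegrableD; last exact: rintegrable_cst.
  exact: integrable_abse (ih i).
- by move=> i x; rewrite addr_ge0.
- move=> i x; rewrite psiC; apply: le_trans (conj_pot_ge _ _ _ _ M0).
  rewrite [X in (_ <= _ - X)%E](_ : _ = (s i)%:E); last first.
    rewrite /s -sumEFin; apply: eq_bigr => j _.
    by rewrite fineK// fin_numE spsi.1 -ltey psi0.
  rewrite -EFinN -EFinB lee_fin.
  have := ch (set_col i x M0); rewrite /osum (bigD1 i)//= col_set_col.
  rewrite (eq_bigr (fun j => h j (col j M0))); last first.
    by move=> j ji; rewrite col_set_col_neq.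
  rewrite -/(t i) ler_norml => /andP[h1 _].
  have := ler_norm (h i x); have := ler_norm (s i + t i); lra.
Qed.

(** Where the coordinates sum to [c], each is [c] minus the others, so the lower bounds of the
    others bound it above; hence [|psi i|] is at most the direct sum of the [h j + g j] almost
    everywhere under the plan. *)
Lemma tight_pot_integrable (psi : epot) g : super_pot c psi ->
  (forall i, lower_semicontinuous (psi i)) ->
  rpot mu g -> (forall i x, 0 <= g i x) -> (forall i x, - (g i x)%:E <= psi i x)%E ->
  {ae gam, forall M, (\sum_(i < d) psi i (col i (M : 'M[R]_d)) = (c M)%:E)%E} ->
  forall i, (mu i).-integrable setT (psi i).
Proof.
move=> spsi lpsi ig g0 gpsi psiE i.
have mpsi : measurable_fun setT (psi i : BorelRd R d -> \bar R).
  exact: borel_lsc_measurable (lpsi i).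
apply: (plan_integrable_inv gamP mpsi); apply/integrableP; split.
  exact: (measurableT_comp mpsi (col_measurable i)).
have iw : rpot mu (fun i x => h i x + g i x) by exact: rpotD.
have iW := plan_rintegrable_osum gamP iw.
apply: (@le_lt_trans _ _ (\int[gam]_M (osum (fun i x => h i x + g i x) M)%:E)%E); last first.
  exact: integrable_lty iW.
have gsum M : 0 <= osum g M by apply: sumr_ge0.
apply: ae_ge0_le_integral => //.
- apply: measurableT_comp => //.
  exact: (measurableT_comp mpsi (col_measurable i)).
- move=> M _; rewrite lee_fin osumD addr_ge0//.
  by apply: le_trans (ch M).
- exact: measurable_int iW.
apply: (@filterS _ _ (ae_filter_ringOfSetsType gam) _ _ _ psiE) => M eqM _.
have fin j : psi j (col j M) \is a fin_num.
  rewrite fin_numE spsi.1 /=; apply/eqP => hj.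
  move: eqM; rewrite (bigD1 j)//= hj addye//; exact: sum_neNy spsi.1.
have hr j : psi j (col j M) = (fine (psi j (col j M)))%:E by rewrite fineK.
have lb j : - g j (col j M) <= fine (psi j (col j M)).
  by rewrite -lee_fin fineK// EFinN.
move: eqM; rewrite (eq_bigr _ (fun j _ => hr j)) sumEFin => -[eqM].
rewrite hr /= lee_fin osumD.
have := lb i; have := g0 i (col i M); have := gsum M.
have : \sum_(j < d | j != i) - g j (col j M) <= \sum_(j < d | j != i) fine (psi j (col j M)).
  exact: ler_sum.
have : \sum_(j < d | j != i) g j (col j M) = osum g M - g i (col i M).
  by rewrite /osum [in RHS](bigD1 i)//=; lra.
have := ch M; rewrite sumrN -eqM [in X in X -> _](bigD1 i)//= => h1 -> h2 h3 h4 h5.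
rewrite ler_norml; move: h1; rewrite ler_norml => /andP[h6 h7].
apply/andP; split; last by lra.
have : osum g M >= g i (col i M).
  rewrite /osum (bigD1 i)//= lerDl; exact: sumr_ge0.
have := ch M; have := normr_ge0 (c M); lra.
Qed.

End integrable_potential.

Theorem duality_attained : exists gam : probability (BorelRdd R d) R,
  exists psi : epot, [/\ transport_plans mu gam, super_pot c psi,
    forall i x, psi i x = conj_pot c psi i x,
    forall i, (mu i).-integrable setT (psi i) &
    (\int[gam]_M (c M)%:E = \sum_(i < d) \int[mu i]_x psi i x)%E].
Proof.
have [gam gamP [phi hphi]] := plan_and_minimizing_potentials.
have gam_c : rintegrable gam c := plan_rintegrable gamP cc ih ch.
have iphi n := plan_rintegrable_osum gamP (let: And3 a _ _ := hphi n in a).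
pose e n (M : BorelRdd R d) := osum (phi n) M - c M.
have ae0 : {ae gam, forall M, (e n M @[n --> \oo] --> (0 : R))}.
  apply: ae_cvg0_summable_integral => n.
  - exact: (rintegrableB (iphi n) gam_c).
  - by move=> M; rewrite subr_ge0; have [_] := hphi n.
  - have [ip _ hp] := hphi n.
    by rewrite (RintegralB measurableT (iphi n) gam_c) (plan_Rintegral_osum gamP ip) lerBlDl.
pose G := [set M : 'M[R]_d | osum (phi n) M - c M @[n --> \oo] --> (0 : R)].
have [M0 GM0] : exists M0, G M0.
  have PF : ProperFilter (almost_everywhere gam).
    apply: ae_properfilter_algebraOfSetsType.
    by have /= -> := probability_setT gam; exact: lte01.
  exact: (@filter_ex _ _ PF G ae0).
have [psi0 [spsi0 psi0G]] := @limit_potential R d c i0 phi G M0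
  (fun n => let: And3 _ a _ := hphi n in a) (fun M GM => GM) GM0.
have [psi [spsi psile psiC]] := conjugate_pot_exists spsi0 (psi0G M0 GM0).2.
have lpsi i : lower_semicontinuous (psi i).
  have -> : psi i = conj_pot c psi i by apply/funext.
  exact: conj_pot_lsc.
have psiM0 i : (psi i (col i M0) < +oo)%E.
  by apply: le_lt_trans (psile _ _) _; exact: (psi0G M0 GM0).2.
(* On [G] the conjugated sum is squeezed between [c] and the sum of the limit tuple, which is [c]
   there. *)
have ae_psi : {ae gam, forall M, (\sum_(i < d) psi i (col i (M : 'M[R]_d)) = (c M)%:E)%E}.
  apply: (@filterS _ _ (ae_filter_ringOfSetsType gam) _ _ _ ae0) => M GM.
  apply/eqP; rewrite eq_le spsi.2 andbT.
  by rewrite -(psi0G M GM).1; apply: lee_sum.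
have [g [ig g0 gpsi]] := conjugate_pot_lower_bound spsi psiC psiM0.
have ipsi := tight_pot_integrable gamP spsi lpsi ig g0 gpsi ae_psi.
exists gam, psi; split => //.
have ip i := plan_integrable gamP (ipsi i).
transitivity (\int[gam]_M (\sum_(i < d) psi i (col i (M : 'M[R]_d))))%E.
  apply: ae_eq_integral => //.
  - exact: measurable_int gam_c.
  - by apply: emeasurable_sum => i; exact: measurable_int (ip i).
  - by apply: (@filterS _ _ (ae_filter_ringOfSetsType gam) _ _ _ ae_psi) => M ->.
rewrite (integral_sum measurableT ip).
by apply: eq_bigr => i _; exact: plan_integral.
Qed.

(** Integrable negative parts exclude [-oo]: either some integral is [+oo] and the bound is trivial,
    or all coordinates are integrable and the pointwise inequality can be integrated against the
    plan. *)
Lemma weak_duality (gam : probability (BorelRdd R d) R) (psi : epot) :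
  transport_plans mu gam -> super_pot c psi ->
  (forall i, measurable_fun setT (psi i : BorelRd R d -> \bar R)) ->
  (forall i, \int[mu i]_x (psi i)^\- x < +oo)%E ->
  (\int[gam]_M (c M)%:E <= \sum_(i < d) \int[mu i]_x psi i x)%E.
Proof.
move=> gamP spsi mpsi npsi.
have nint i : (\int[mu i]_x (psi i)^\- x \is a fin_num)%E.
  by rewrite ge0_fin_numE ?npsi//; exact: integral_ge0.
have intN i : (\int[mu i]_x psi i x != -oo)%E.
  have pint : (0 <= \int[mu i]_x (psi i)^\+ x)%E by exact: integral_ge0.
  rewrite integralE.
  exact: (sube_neNy pint (nint i)).
have [ilt|] := pselect (forall i, \int[mu i]_x psi i x < +oo)%E; last first.
  move=> /existsNP[i /negP]; rewrite -leNgt leye_eq => /eqP hi.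
  rewrite (bigD1 i)//= hi addye ?leey// esum_eqNy; apply/negP.
  by move=> /existsP[j /andP[_ /eqP hj]]; have := intN j; rewrite hj.
have ipsi i : (mu i).-integrable setT (psi i).
  apply/integrableP; split => //.
  under eq_integral do rewrite -/((abse \o psi i) _) fune_abse.
  rewrite ge0_integralD//; [|exact: measurable_funepos|exact: measurable_funeneg].
  rewrite lte_add_pinfty ?npsi//.
  by apply: (sube_ltyl (nint i)); rewrite -integralE; exact: ilt.
have ip i := plan_integrable gamP (ipsi i).
have -> : (\sum_(i < d) \int[mu i]_x psi i x =
    \int[gam]_M (\sum_(i < d) psi i (col i (M : 'M[R]_d))))%E.
  rewrite (integral_sum measurableT ip).
  by apply: eq_bigr => i _; rewrite (plan_integral gamP).
apply: le_integral => //.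
- exact: (plan_rintegrable gamP cc ih ch).
- exact: integrable_sum.
- by move=> M _; exact: spsi.2.
Qed.

End duality.

(** * The determinant *)

Section determinant.
Context {R : realType} {d : nat}.

Lemma continuous_bigM (T : topologicalType) (I : Type) (s : seq I) (f : I -> T -> R) :
  (forall i, continuous (f i)) -> continuous (fun x => \prod_(i <- s) f i x).
Proof.
move=> cf; elim: s => [|i s ih].
  by under eq_fun do rewrite big_nil; move=> x; exact: cst_continuous.
under eq_fun do rewrite big_cons; move=> x.
by apply: continuousM; [exact: cf|exact: ih].
Qed.

Lemma continuous_bigD (T : topologicalType) (I : Type) (s : seq I) (f : I -> T -> R) :
  (forall i, continuous (f i)) -> continuous (fun x => \sum_(i <- s) f i x).
Proof.
move=> cf; elim: s => [|i s ih].
  by under eq_fun do rewrite big_nil; move=> x; exact: cst_continuous.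
under eq_fun do rewrite big_cons; move=> x.
by apply: continuousD; [exact: cf|exact: ih].
Qed.

Lemma det_continuous : continuous (fun M : 'M[R]_d => \det M).
Proof.
apply: (@continuous_bigD _ _ _ (fun (s : 'S_d) (M : 'M[R]_d) =>
  (-1) ^+ s * \prod_i M i (s i))) => s M.
apply: (@continuousM _ _ (fun=> (-1) ^+ s) (fun M : 'M[R]_d => \prod_i M i (s i))).
  exact: cst_continuous.
apply: (@continuous_bigM _ _ _ (fun i (M : 'M[R]_d) => M i (s i))) => i.
exact: coord_continuous.
Qed.

Lemma enorm_ge_coord (x : 'cV[R]_d) k : `|x k 0| <= enorm x.
Proof.
rewrite /enorm -sqrtr_sqr ler_sqrt ?sumr_ge0//; last by move=> i _; exact: sqr_ge0.
rewrite (bigD1 k)//= lerDl; apply: sumr_ge0 => i _; exact: sqr_ge0.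
Qed.

Lemma det_le_prod_enorm (M : 'M[R]_d) :
  `|\det M| <= d`!%:R * \prod_(i < d) enorm (col i M).
Proof.
(* After transposing, each Leibniz product takes the entries [M (s i) i], one per column; [d!]
   counts the permutations. *)
rewrite -det_tr /determinant; apply: le_trans (ler_norm_sum _ _ _) _.
apply: (@le_trans _ _ (\sum_(s : 'S_d) \prod_(i < d) enorm (col i M))).
  apply: ler_sum => s _; rewrite normrM normrX normrN1 expr1n mul1r normr_prod.
  apply: ler_prod => i _; rewrite normr_ge0 /= mxE.
  by have := enorm_ge_coord (col i M) (s i); rewrite mxE.
by rewrite sumr_const card_Sn mulr_natl.
Qed.

Lemma enorm_continuous : continuous (@enorm R d).
Proof.
move=> x; apply: (@continuous_comp _ _ _ (fun x : 'cV[R]_d => \sum_(k < d) x k 0 ^+ 2) Num.sqrt).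
  apply: (@continuous_bigD _ _ _ (fun k (x : 'cV[R]_d) => x k 0 ^+ 2)) => k y.
  by apply: continuousM; exact: coord_continuous.
exact: sqrt_continuous.
Qed.

End determinant.

(** With [S] the right-hand side, each [t i] is at most [S] to the power [1 / p i], and these
    exponents add up to 1. A form of Young's inequality whose constants suffice for domination. *)
Lemma prod_le_sum_powR (R : realType) (d : nat) (p t : 'I_d -> R) :
  (forall i, 0 < p i) -> \sum_(i < d) (p i)^-1 = 1 -> (forall i, 0 <= t i) ->
  \prod_(i < d) t i <= \sum_(i < d) t i `^ p i.
Proof.
move=> p0 psum t0; pose S := \sum_(i < d) t i `^ p i.
have S0 : 0 <= S by apply: sumr_ge0 => i _; exact: powR_ge0.
have tS i : t i <= S `^ (p i)^-1.
  have -> : t i = (t i `^ p i) `^ (p i)^-1.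
    by rewrite -powRrM mulfV ?gt_eqF// powRr1.
  apply: ge0_ler_powR.
  - by rewrite invr_ge0 ltW.
  - by rewrite nnegrE powR_ge0.
  - by rewrite nnegrE.
  - by rewrite /S [leRHS](bigD1 i)//= lerDl; apply: sumr_ge0 => j _; exact: powR_ge0.
have SE : \prod_(i < d) S `^ (p i)^-1 = S.
  transitivity (S `^ (\sum_(i < d) (p i)^-1)); last by rewrite psum powRr1.
  elim: (index_enum _) => [|i s ih]; first by rewrite !big_nil powRr0.
  (* At a possibly zero base, adding exponents requires a nonzero total. *)
  rewrite !big_cons ih powRD//; apply/implyP => /eqP h.
  have : 0 < (p i)^-1 + \sum_(j <- s) (p j)^-1.
    by rewrite ltr_wpDr ?invr_gt0//; apply: sumr_ge0 => j _; rewrite invr_ge0 ltW.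
  by rewrite h ltxx.
rewrite -[leRHS]SE; apply: ler_prod => i _; by rewrite t0 tS.
Qed.
Theorem theorem3p2 (R : realType) (d : nat)
    (mu : 'I_d -> probability (BorelRd R d) R) (p : 'I_d -> R)
    (hp1 : forall i, 1 < p i)
    (hpsum : \sum_(i < d) (p i)^-1 = 1)
    (hmom : (\sum_(i < d)
               \int[mu i]_(x in setT) ((enorm (x : 'cV[R]_d) `^ p i) / p i)%:E
             < +oo)%E) :
  exists gam : probability (BorelRdd R d) R,
  exists phi : 'I_d -> 'cV[R]_d -> \bar R,
    [/\ transport_plans mu gam /\
          (forall gam', transport_plans mu gam' -> (MK_cost gam' <= MK_cost gam)%E),
        admissible mu phi,
        (forall phi', admissible mu phi' -> (dual_cost mu phi <= dual_cost mu phi')%E),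
        MK_cost gam = dual_cost mu phi &
        conjugate_tuple phi].
Proof.
have p0 i : 0 < p i by apply: lt_trans (hp1 i).
(* An empty sum of reciprocals would be 0, not 1. *)
have d0 : (0 < d)%N.
  rewrite lt0n; apply/eqP => d0; move: hpsum; rewrite big1 => [/eqP|[i ilt] _].
    by rewrite eq_sym oner_eq0.
  by exfalso; rewrite d0 in ilt.
pose i0 := Ordinal d0.
(* [d!] comes from the determinant bound, the power [p i] from bounding the product of norms by a
   sum of powers. *)
pose h (i : 'I_d) (x : 'cV[R]_d) : R := d`!%:R * enorm x `^ p i.
have mh i : measurable_fun setT ((fun x : 'cV[R]_d => enorm x `^ p i) : BorelRd R d -> R).
  apply: (@measurableT_comp _ _ _ _ _ _ (fun y : R => y `^ p i)).
    exact: measurable_powR.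
  by apply: borel_continuous_measurable; exact: enorm_continuous.
have ih : rpot mu h.
  move=> i; apply: rintegrableZ.
  have hi : rintegrable (mu i) (fun x : 'cV[R]_d => enorm x `^ p i / p i).
    apply/integrableP; split.
      by apply/measurable_EFinP; apply: measurable_funM => //; exact: mh.
    (* The terms of the moment sum are nonnegative, so each is finite; the factor [1 / p i] is
       undone afterwards. *)
    apply: le_lt_trans hmom; rewrite (bigD1 i)//=.
    under eq_integral do rewrite ger0_norm ?divr_ge0 ?powR_ge0 ?ltW//.
    rewrite leeDl//; apply: sume_ge0 => j _; apply: integral_ge0 => x _.
    by rewrite lee_fin divr_ge0 ?powR_ge0 ?ltW.
  have := rintegrableZ (p i) hi; congr (rintegrable _ _).
  by apply/funext => x; rewrite mulrCA mulfV ?mulr1// gt_eqF.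
have ch (M : 'M[R]_d) : `|\det M| <= osum h M.
  apply: le_trans (det_le_prod_enorm M) _; rewrite /osum /h -mulr_sumr ler_wpM2l//.
  by apply: prod_le_sum_powR => // i; exact: sqrtr_ge0.
have [gam [phi [gamP sphi phiC iphi eqv]]] := duality_attained i0 det_continuous ih ch.
have lphi i : lower_semicontinuous (phi i).
  have -> : phi i = conj_pot (fun M => \det M) phi i by apply/funext.
  exact: (conj_pot_lsc det_continuous).
(* Stated for arbitrary competitors, so that with the equality of costs it gives optimality on both
   sides. *)
have wd gam' phi' : transport_plans mu gam' -> admissible mu phi' ->
    (MK_cost gam' <= dual_cost mu phi')%E.
  move=> gamP' [l' n' s' i']; apply: (weak_duality det_continuous ih ch) => //.
  by move=> i; exact: borel_lsc_measurable.
have aphi : admissible mu phi.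
  split => //; [exact: sphi.1|exact: sphi.2|].
  by move=> i; exact: (integral_funeneg_lt_pinfty measurableT (iphi i)).
exists gam, phi; split => //.
- by split => // gam' /wd/(_ aphi); rewrite [leRHS](_ : _ = MK_cost gam).
- by move=> phi' /(wd _ _ gamP); rewrite [X in (X <= _)%E](_ : _ = dual_cost mu phi).
Qed.
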